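(* Let $1\le p\le q\le\infty$. Let $(X,\mu)$ be a measure space, with $\mu$ semi-finite if $p=1$. Let $X=X_1\cup X_2\cup\cdots$ be a partition of $X$ and set $X^{(n)}:=X_1\cup\cdots\cup X_n$. Let $(b_n)_{n\ge1}$ and $(M_n)_{n\ge1}$ be sequences of weights. Let $m$ be a measurable function on $X$ and let $w_n$ be the $L^{p'}$-norm of $m$ on $X_n$. Put $$\beta:=\sup_{N\ge1}\left(\sum_{n=N}^{\infty}\frac{b_n}{M_n^q}\right)^{1/q}\left(\sum_{k=1}^N\frac{w_k^{p'}}{b_k^{p'/p}}\right)^{1/p'}.$$ Then there exists a finite constant $C>0$ such that $$\left(\sum_{n=1}^{\infty}b_n\left|\frac1{M_n}\int_{X^{(n)}}m(x)f(x)\,\mathrm{d}\mu(x)\right|^q\right)^{1/q}\le C\left(\sum_{n=1}^{\infty}b_n\int_{X_n}|f(x)|^p\,\mathrm{d}\mu(x)\right)^{1/p}$$ for every measurable function $f$ if and only if $\beta<\infty$; and when $\beta<\infty$ the inequality holds for every measurable $f$ with $C=p^{1/q}(p')^{1/p'}\beta$.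
   Context: A sequence of weights is any sequence of positive numbers. The partition is a countable partition into measurable sets. $p'$ is the Hölder conjugate of $p$, i.e. $\frac1p+\frac1{p'}=1$. Functions are complex-valued. The numbers $w_n$ are $$w_n=\left(\int_{X_n}|m(x)|^{p'}\,\mathrm{d}\mu(x)\right)^{1/p'}\ \text{if } p>1,\qquad w_n=\operatorname{ess\,sup}_{x\in X_n}|m(x)|\ \text{if } p=1.$$ The endpoint cases are read with the obvious modifications. If $q=\infty$, the left-hand side is $\sup_{b_n>0}\left|\frac1{M_n}\int_{X^{(n)}}mf\,\mathrm{d}\mu\right|$ and the first factor in $\beta$ is $\sup_{n\ge N}\frac1{M_n}$. If $p=1$, the second factor in $\beta$ is $\max_{1\le k\le N}w_k/b_k$. If $p=\infty$ (so $q=\infty$, $p'=1$), the second factor in $\beta$ is $\sum_{k=1}^Nw_k$, and the right-hand side of the inequality (apart from $C$) is $\operatorname{ess\,sup}_{\cup_{b_n>0}X_n}|f(x)|$. In the constant $p^{1/q}(p')^{1/p'}$, one sets $p^{1/q}=1$ if $q=\infty$ and $(p')^{1/p'}=1$ if $p=1$.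
   Formalization: For 1<p<∞ it is additionally assumed that μ is semi-finite or that all w_n are finite; otherwise ''only if'' fails (one point of infinite mass, m=1, p=q=2, b_n=1, M_n=2^n: only f=0 has a finite right side, yet β=∞). *)

(* Defs.v *)
From HB Require Import structures.
From mathcomp Require Import all_boot all_order all_algebra.
From mathcomp Require Import all_classical all_reals all_analysis.
From mathcomp Require Import complex.
Import Order.TTheory GRing.Theory Num.Theory.
Import numFieldNormedType.Exports.

Set Implicit Arguments.
Unset Strict Implicit.
Unset Printing Implicit Defensive.

Local Open Scope classical_set_scope.
Local Open Scope ring_scope.

(* The sequences are indexed from 0: the n-th term here is the (n+1)-st term
   of a sequence indexed by n >= 1. *)

Definition cabs (R : realType) (z : R[i]) : R := Normc.normc z.

Definition cmeasurable d (T : measurableType d) (R : realType)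
    (f : T -> R[i]) : Prop :=
  measurable_fun [set: T] (fun x => complex.Re (f x)) /\
  measurable_fun [set: T] (fun x => complex.Im (f x)).

Definition cintegrable d (T : measurableType d) (R : realType)
    (mu : {measure set T -> \bar R}) (A : set T) (g : T -> R[i]) : Prop :=
  mu.-integrable A (fun x => (complex.Re (g x))%:E) /\
  mu.-integrable A (fun x => (complex.Im (g x))%:E).

Definition cintegral d (T : measurableType d) (R : realType)
    (mu : {measure set T -> \bar R}) (A : set T) (g : T -> R[i]) : R[i] :=
  Complex (\int[mu]_(x in A) complex.Re (g x))
          (\int[mu]_(x in A) complex.Im (g x)).

(* Semi-finiteness is what lets the L^p'-norm of m be recovered by testing
   against functions of finite L^p-norm: if X is one atom of infinite measure
   and m = 1, then for 1 < p < +oo only f = 0 has finite L^p-norm, so the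
   inequality holds with every C although the L^p'-norm of m is +oo.  For
   1 < p < +oo it is not needed when the numbers w_n are finite, as m is then
   supported on a sigma-finite set. *)
Definition semifinite d (T : measurableType d) (R : realType)
    (mu : {measure set T -> \bar R}) : Prop :=
  forall A, measurable A -> mu A = +oo%E ->
    exists B, [/\ measurable B, B `<=` A & (0 < mu B < +oo)%E].

Section hardy.
Context d (T : measurableType d) (R : realType).
Variable mu : {measure set T -> \bar R}.
Implicit Types (p q : \bar R) (X : nat -> set T) (b M : nat -> R)
  (m f : T -> R[i]) (w : nat -> \bar R).

Local Open Scope ereal_scope.

(* The L^p-norm of g on A.  Restricting g by 0, rather than mu to A, makes the
   essential supremum over a null set A equal to 0 and not -oo. *)
Definition Lnorm_on p (A : set T) (g : T -> R[i]) : \bar R :=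
  'N[mu]_p[(fun x => (cabs (g x))%:E) \_ A].

(* |c int_A g|, read as +oo when g is not integrable on A, so that an
   inequality bounding it by a finite quantity asserts that the integral
   exists. *)
Definition abs_scaled_cintegral (c : R) (A : set T) (g : T -> R[i]) : \bar R :=
  if `[< cintegrable mu A g >] then (cabs (c%:C%C * cintegral mu A g)%R)%:E
  else +oo.

(* In the definitions by cases on an exponent p or q (always at least 1 in
   use), the last branch is the case of the exponent +oo. *)

Definition hardy_lhs q X b M m f : \bar R :=
  let avg n := abs_scaled_cintegral (M n)^-1 (\bigcup_(k in `I_n.+1) X k)
                 (fun x => m x * f x)%R in
  match q with
  | q%:E => (\sum_(0 <= n <oo) (b n)%:E * avg n `^ q) `^ q^-1
  | _ => ereal_sup [set avg n | n in [set n | (0 < b n)%R]]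
  end.

Definition hardy_rhs p X b f : \bar R :=
  match p with
  | p%:E => (\sum_(0 <= n <oo)
              (b n)%:E * \int[mu]_(x in X n) (cabs (f x) `^ p)%:E) `^ p^-1
  | _ => Lnorm_on +oo (\bigcup_(n in [set n | (0 < b n)%R]) X n) f
  end.

Definition beta_left q b M (N : nat) : \bar R :=
  match q with
  | q%:E => (\sum_(N <= n <oo) (b n / M n `^ q)%:E) `^ q^-1
  | _ => ereal_sup [set ((M n)^-1)%:E | n in [set n | (N <= n)%N]]
  end.

Definition beta_right p b w (N : nat) : \bar R :=
  let p' := fine (hoelder_conjugate p) in
  match p with
  | p%:E =>
    if p == 1%R then \big[maxe/0]_(0 <= k < N.+1) (w k * ((b k)^-1)%:E)
    else (\sum_(0 <= k < N.+1) w k `^ p' * ((b k `^ (p' / p))^-1)%:E) `^ p'^-1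
  | _ => \sum_(0 <= k < N.+1) w k
  end.

(* In \bar R, 0 * +oo = 0: a term whose right factor vanishes contributes 0. *)
Definition hardy_beta p q b M w : \bar R :=
  ereal_sup [set beta_left q b M N * beta_right p b w N | N in [set: nat]].

Definition hardy_const p q : R :=
  ((if q is q%:E then fine p `^ q^-1 else 1) *
   (if hoelder_conjugate p is p'%:E then p' `^ p'^-1 else 1))%R.

End hardy.

(* Main.v *)
Require Import Defs.
From HB Require Import structures.
From mathcomp Require Import all_boot all_order all_algebra.
From mathcomp Require Import all_classical all_reals all_analysis.
From mathcomp Require Import measurable_realfun ess_sup_inf.
From mathcomp Require Import complex.
From mathcomp Require Import ring lra.
Import Order.TTheory GRing.Theory Num.Theory.
Import numFieldNormedType.Exports.

Set Implicit Arguments.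
Unset Strict Implicit.
Unset Printing Implicit Defensive.

Local Open Scope classical_set_scope.
Local Open Scope ring_scope.

(** The inequality for functions is an inequality between sequences in disguise.
    If a_k is the L^p-norm of f on X_k, Hoelder's inequality on every block gives
      |int_(X_0 u ... u X_n) m f| <= sum_(k <= n) w_k a_k,
    and the right-hand side of the theorem is the weighted l^p-norm of (a_k).

    Sufficiency of beta < +oo is therefore a discrete Hardy inequality
    ([hardy_sequence]).  For 1 < p <= q < +oo it is proved by Bradley's method
    ([discrete_hardy]).  Normalise the weights by v_k = w_k / b_k^(1/p),
    c_k = b_k^(1/p) a_k, u_n = b_n / M_n^q, and let V_n be the n-th partial sum
    of v^p' and U_n the n-th tail of u, so that U_n^(1/q) V_n^(1/p') <= beta.
    Hoelder's inequality with the auxiliary weight V_k^(1/(p p')) bounds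
    sum_(k <= n) v_k c_k, and Minkowski's inequality with exponent q/p
    exchanges the two summations.  What remains are the sums of
    v_k^p' V_k^(-1/p) and of u_n U_n^(-1/p'); as t^(1/p') and t^(1/p) are
    concave, these are dominated by the telescoping sums of p' V^(1/p') and
    p U^(1/p).  These two factors make up the constant p^(1/q) p'^(1/p').  Only
    finite sections of the sums enter, hence only real numbers, and the limit
    is taken at the very end.  For p = 1 Minkowski's inequality is enough, and
    for q = +oo Hoelder's.

    For necessity, the inequality is tested on f = conj(sgn m) phi with
    phi >= 0, for which m f = |m| phi, so that the integrals have no
    cancellation ([hardy_test]).  If all the integrals over X_0 u ... u X_n
    with n >= N are at least V, the left-hand side is at least V times the
    first factor of beta at N.  The function phi is an extremal of Hoelder's
    inequality: a constant for p = +oo, b_k^(-p'/p) |m|^(p'-1) on X_k with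
    k <= N for 1 < p < +oo, and the indicator of a set on which |m| is nearly
    its essential supremum for p = 1.  When this phi has infinite norm it is
    cut down to a set A of finite but large mass, which exists because mu is
    semi-finite ([semifinite_large_integral]). *)

(** * Finite sums of real numbers *)

Section finite_sums.
Context {R : realType}.
Implicit Types (p q r a : R).

Lemma powRVK a r : r != 0 -> 0 <= a -> (a `^ r^-1) `^ r = a.
Proof. by move=> r0 a0; rewrite -powRrM mulVf// powRr1. Qed.

Lemma powRKV a r : r != 0 -> 0 <= a -> (a `^ r) `^ r^-1 = a.
Proof. by move=> r0 a0; rewrite -powRrM mulfV// powRr1. Qed.

Lemma hoelder_sum (I : Type) (s : seq I) (P : pred I) (x y : I -> R) p q :
  (forall i, 0 <= x i) -> (forall i, 0 <= y i) ->
  0 < p -> 0 < q -> p^-1 + q^-1 = 1 ->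
  \sum_(i <- s | P i) x i * y i <=
  (\sum_(i <- s | P i) x i `^ p) `^ p^-1 *
  (\sum_(i <- s | P i) y i `^ q) `^ q^-1.
Proof.
move=> x0 y0 p0 q0 pq; elim: s => [|i s IH].
  by rewrite !big_nil mulr_ge0 ?powR_ge0.
rewrite !big_cons; case: ifP => // _.
set X := \sum_(_ <- _ | _) _ `^ p in IH *.
set Y := \sum_(_ <- _ | _) _ `^ q in IH *.
have X0 : 0 <= X by apply: sumr_ge0 => j _; apply: powR_ge0.
have Y0 : 0 <= Y by apply: sumr_ge0 => j _; apply: powR_ge0.
have := hoelder2 (x0 i) (powR_ge0 X p^-1) (y0 i) (powR_ge0 Y q^-1) p0 q0 pq.
rewrite !powRVK ?gt_eqF//; apply: le_trans.
by rewrite lerD2l.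
Qed.

(** With D_i = sum_k y_ki, write D_i^r = sum_k y_ki D_i^(r-1), exchange the sums
    and apply Hoelder's inequality to the sum over i: each term yields the norm
    of y_k times (sum_i D_i^r)^(1/r'), and the latter factor cancels. *)
Lemma minkowski_sum (I K : Type) (s : seq I) (t : seq K) (y : K -> I -> R) r :
  (forall k i, 0 <= y k i) -> 1 <= r ->
  (\sum_(i <- s) (\sum_(k <- t) y k i) `^ r) `^ r^-1 <=
  \sum_(k <- t) (\sum_(i <- s) y k i `^ r) `^ r^-1.
Proof.
move=> y0 r1.
have D0 i : 0 <= \sum_(k <- t) y k i by apply: sumr_ge0.
have [->|rN1] := eqVneq r 1.
  rewrite invr1 powRr1; last by apply: sumr_ge0 => i _; apply: powR_ge0.
  rewrite (eq_bigr (fun i => \sum_(k <- t) y k i)); last first.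
    by move=> i _; rewrite powRr1.
  rewrite exchange_big/=; apply: ler_sum => k _.
  rewrite powRr1; last by apply: sumr_ge0 => i _; apply: powR_ge0.
  by apply: ler_sum => i _; rewrite powRr1.
have {rN1} r1' : 1 < r by rewrite lt_neqAle eq_sym rN1.
have r0 : 0 < r by exact: lt_trans r1'.
set D := fun i => \sum_(k <- t) y k i.
set S := \sum_(i <- s) _.
have S0 : 0 <= S by apply: sumr_ge0 => i _; apply: powR_ge0.
have [->|SN0] := eqVneq S 0.
  by rewrite powR0 ?invr_eq0 ?gt_eqF//; apply: sumr_ge0 => i _; apply: powR_ge0.
pose r' := r / (r - 1).
have rr0 : 0 < r - 1 by rewrite subr_gt0.
have r'0 : 0 < r' by rewrite divr_gt0.
have rr' : r^-1 + r'^-1 = 1 by rewrite /r' invf_div; field; rewrite gt_eqF.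
have SE : S = \sum_(k <- t) \sum_(i <- s) y k i * D i `^ (r - 1).
  rewrite exchange_big/=; apply: eq_bigr => i _.
  by rewrite -mulr_suml mulr_powRB1.
have : S <= \sum_(k <- t) (\sum_(i <- s) y k i `^ r) `^ r^-1 * S `^ r'^-1.
  rewrite {1}SE; apply: ler_sum => k _.
  apply: le_trans (hoelder_sum _ _ (y0 k) _ r0 r'0 rr') _.
    by move=> i; apply: powR_ge0.
  rewrite le_eqVlt; apply/orP; left; apply/eqP; congr (_ * _ `^ _).
  apply: eq_bigr => i _; rewrite -powRrM; congr (_ `^ _).
  by rewrite /r'; field; rewrite gt_eqF.
rewrite -mulr_suml => H.
have Sr' : 0 < S `^ r'^-1 by rewrite powR_gt0// lt_neqAle eq_sym SN0.
rewrite -(ler_pM2r Sr') -powRD ?rr' ?oner_eq0//.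
by rewrite powRr1.
Qed.

(** The tangent at x lies above the concave function t^a: up to the factor
    x^a, this is Young's inequality t^a <= a t + (1 - a) at t = y / x.  It makes
    the sums of the next section telescope. *)
Lemma concave_powR_diff x y a : 0 <= y -> y <= x -> 0 < a -> a <= 1 ->
  (x - y) * x `^ (a - 1) <= a^-1 * (x `^ a - y `^ a).
Proof.
move=> y0 yx a0 a1.
have [x0|xN0] := eqVneq x 0.
  have -> : y = x by apply/eqP; rewrite eq_le yx x0 y0.
  by rewrite !subrr mul0r mulr0.
have x0 : 0 < x by rewrite lt_neqAle eq_sym xN0 (le_trans y0).
have [->|aN1] := eqVneq a 1.
  by rewrite subrr powRr0 mulr1 invr1 mul1r !powRr1 ?(ltW x0).
have {}a1 : a < 1 by rewrite lt_neqAle aN1.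
pose t := y / x.
have t0 : 0 <= t by rewrite divr_ge0// ltW.
have yE : y = t * x by rewrite /t divfK ?gt_eqF.
have xa : x * x `^ (a - 1) = x `^ a by rewrite mulr_powRB1// ltW.
have tE : t `^ a <= a * t + (1 - a).
  have := @conjugate_powR R (t `^ a) 1 a^-1 (1 - a)^-1.
  rewrite mulr1 powR1 !invrK powRKV ?gt_eqF//.
  have := powR_ge0 t a; rewrite mul1r (mulrC t).
  by move=> + /(_ _ _ _ _ _) => h; apply => //; rewrite ?invr_gt0 ?subr_gt0//; ring.
rewrite {1 2}yE powRM ?(ltW x0)//.
have -> : (x - t * x) * x `^ (a - 1) = (1 - t) * x `^ a by rewrite -xa; ring.
have -> : a^-1 * (x `^ a - t `^ a * x `^ a) = (a^-1 * (1 - t `^ a)) * x `^ a by ring.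
rewrite ler_pM2r ?powR_gt0//.
rewrite ler_pdivlMl//.
lra.
Qed.

End finite_sums.

(** * The discrete Hardy inequality *)

Section discrete_hardy.
Context {R : realType}.
Implicit Types (p q r a : R) (u v c : nat -> R).

(** By concavity, each term is at most the increment of a^-1 S^a, where S is the
    partial sum. *)
Lemma prefix_sum_powR v a n : (forall k, 0 <= v k) -> 0 < a -> a <= 1 ->
  \sum_(0 <= k < n) v k * (\sum_(0 <= j < k.+1) v j) `^ (a - 1) <=
  a^-1 * (\sum_(0 <= j < n) v j) `^ a.
Proof.
move=> v0 a0 a1; elim: n => [|n IH].
  by rewrite !big_nil mulr_ge0 ?powR_ge0// invr_ge0 ltW.
rewrite big_nat_recr//= big_nat_recr//=.
set S := \sum_(0 <= j < n) v j in IH *.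
have S0 : 0 <= S by apply: sumr_ge0.
have := @concave_powR_diff R (S + v n) S a S0 _ a0 a1.
rewrite lerDl addrAC subrr add0r => /(_ (v0 n)) h.
apply: le_trans (lerD IH h) _.
by rewrite -mulrDr subrKC.
Qed.

(** The mirror image of [prefix_sum_powR]; the sums are truncated at L, which
    keeps the tails finite. *)
Lemma tail_sum_powR u a (k L : nat) : (forall k, 0 <= u k) -> 0 < a -> a <= 1 ->
  \sum_(k <= n < L) u n * (\sum_(n <= j < L) u j) `^ (a - 1) <=
  a^-1 * (\sum_(k <= j < L) u j) `^ a.
Proof.
move=> u0 a0 a1.
have [Lk|/ltnW kL] := leqP L k.
  by rewrite !big_geq// mulr_ge0 ?powR_ge0// invr_ge0 ltW.
rewrite -(subKn kL); elim: (L - k)%N (leq_subr k L) => [|d IH] dL.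
  by rewrite subn0 !big_geq// mulr_ge0 ?powR_ge0// invr_ge0 ltW.
have {}IH := IH (ltnW dL).
have kL' : (L - d.+1 < L)%N by rewrite ltn_subrL (leq_trans _ dL).
have E : (L - d.+1).+1 = (L - d)%N by rewrite subnS prednK// subn_gt0.
rewrite big_ltn// [X in X `^ a]big_ltn// E.
rewrite [X in X `^ (a - 1)]big_ltn// E.
set S := \sum_(L - d <= j < L) u j in IH *.
have S0 : 0 <= S by apply: sumr_ge0.
have := @concave_powR_diff R (S + u (L - d.+1)%N) S a S0 _ a0 a1.
rewrite lerDl addrAC subrr add0r => /(_ (u0 _)) h.
rewrite (addrC _ S).
apply: le_trans (lerD h IH) _.
by rewrite -mulrDr subrK.
Qed.

(** Minkowski's inequality for the triangular array u_n^(1/r) d_k, k <= n. *)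
Lemma minkowski_prefix u (d : nat -> R) r (L : nat) : (forall n, 0 <= u n) ->
  (forall n, 0 <= d n) -> 1 <= r ->
  (\sum_(0 <= n < L) u n * (\sum_(0 <= k < n.+1) d k) `^ r) `^ r^-1 <=
  \sum_(0 <= k < L) d k * (\sum_(k <= n < L) u n) `^ r^-1.
Proof.
move=> u0 d0 r1.
have r0 : 0 < r by exact: lt_le_trans r1.
pose y k n := (if (k <= n)%N then u n `^ r^-1 * d k else 0).
have y0 k n : 0 <= y k n by rewrite /y; case: ifP => // _; rewrite mulr_ge0 ?powR_ge0.
have := @minkowski_sum R nat nat (index_iota 0 L) (index_iota 0 L) y r y0 r1.
congr (_ `^ _ <= _).
  rewrite !big_seq; apply: eq_bigr => n; rewrite mem_index_iota => /andP[_ nL].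
  rewrite (@big_cat_nat _ _ _ n.+1)//=.
  rewrite [X in _ + X]big1_seq ?addr0; last first.
    move=> k /=; rewrite mem_index_iota => /andP[nk _].
    by rewrite /y leqNgt nk.
  rewrite (_ : \sum_(0 <= i < n.+1) y i n = u n `^ r^-1 * \sum_(0 <= k < n.+1) d k).
    by rewrite powRM ?powR_ge0// ?sumr_ge0// powRVK ?gt_eqF.
  rewrite mulr_sumr !big_seq; apply: eq_bigr => k.
  by rewrite mem_index_iota ltnS => /andP[_ kn]; rewrite /y kn.
rewrite !big_seq; apply: eq_bigr => k; rewrite mem_index_iota => /andP[_ kL].
rewrite (@big_cat_nat _ _ _ k)//=; last exact: ltnW.
rewrite [X in X + _]big1_seq ?add0r; last first.
  move=> n /=; rewrite mem_index_iota => /andP[_ nk].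
  by rewrite /y leqNgt nk/= powR0// gt_eqF.
rewrite (_ : \sum_(k <= n < L) y k n `^ r = d k `^ r * \sum_(k <= n < L) u n).
  by rewrite powRM ?powR_ge0 ?sumr_ge0// powRKV// gt_eqF.
rewrite mulr_sumr !big_seq; apply: eq_bigr => n.
rewrite mem_index_iota => /andP[kn _]; rewrite /y kn.
by rewrite powRM ?powR_ge0// powRVK ?gt_eqF// mulrC.
Qed.

(** Bradley's argument.  With V_n the partial sums of v^p' and U_n the tails of
    u, the hypothesis reads U_N^(1/q) V_N^(1/p') <= B; it is used twice, to
    trade V_n for a negative power of U_n inside the tails, and to collect the
    powers of U_k and V_k that are left at the end. *)
Lemma discrete_hardy p p' q u v c (B : R) (L : nat) :
  0 < p -> 0 < p' -> p^-1 + p'^-1 = 1 -> p <= q ->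
  (forall n, 0 <= u n) -> (forall k, 0 <= v k) -> (forall k, 0 <= c k) ->
  0 <= B ->
  (forall N, (N < L)%N -> (\sum_(N <= n < L) u n) `^ q^-1 *
     (\sum_(0 <= k < N.+1) v k `^ p') `^ p'^-1 <= B) ->
  (\sum_(0 <= n < L) u n * (\sum_(0 <= k < n.+1) v k * c k) `^ q) `^ q^-1 <=
  p `^ q^-1 * p' `^ p'^-1 * B * (\sum_(0 <= k < L) c k `^ p) `^ p^-1.
Proof.
move=> p0 p'0 pp' pq u0 v0 c0 B0 HB.
have q0 : 0 < q by exact: lt_le_trans pq.
have pn : p != 0 by rewrite gt_eqF.
have p'n : p' != 0 by rewrite gt_eqF.
have qn : q != 0 by rewrite gt_eqF.
pose V n := \sum_(0 <= k < n.+1) v k `^ p'.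
pose U n := \sum_(n <= j < L) u j.
have V0 n : 0 <= V n by apply: sumr_ge0 => *; apply: powR_ge0.
have U0 n : 0 <= U n by apply: sumr_ge0.
have ppV : p'^-1 - 1 = - p^-1 by rewrite -pp'; ring.
have ppU : p^-1 - 1 = - p'^-1 by rewrite -pp'; ring.
have a'0 : 0 < p'^-1 by rewrite invr_gt0.
have a0 : 0 < p^-1 by rewrite invr_gt0.
have a'1 : p'^-1 <= 1 by rewrite -pp' lerDr ltW.
have a1 : p^-1 <= 1 by rewrite -pp' lerDl ltW.
(* Inserting V_k^(1/(p p')) turns the v-factor of Hoelder's inequality into
   the sum of v_k^p' V_k^(1/p' - 1), which telescopes. *)
have H1 n : \sum_(0 <= k < n.+1) v k * c k <=
    (\sum_(0 <= k < n.+1) c k `^ p * V k `^ p'^-1) `^ p^-1 *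
    (p' * V n `^ p'^-1) `^ p'^-1.
  have := @hoelder_sum R nat (index_iota 0 n.+1) xpredT
    (fun k => c k * V k `^ (p^-1 * p'^-1)) (fun k => v k * V k `^ - (p^-1 * p'^-1))
    p p' _ _ p0 p'0 pp'.
  have E : \sum_(0 <= i < n.+1) c i * V i `^ (p^-1 * p'^-1) *
      (v i * V i `^ - (p^-1 * p'^-1)) = \sum_(0 <= k < n.+1) v k * c k.
    (* If V_k = 0 the inserted weight is 0, but then v_k = 0 as well. *)
    apply: eq_bigr => k _; rewrite powRN.
    have [Vk|Vk] := eqVneq (V k) 0; last first.
      by rewrite mulrACA divff ?mulr1 1?mulrC// powR_eq0 negb_and Vk.
    have : v k `^ p' <= 0.
      rewrite -Vk /V big_nat_recr//= lerDr sumr_ge0// => *.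
      exact: powR_ge0.
    rewrite le_eqVlt ltNge powR_ge0 orbF => /eqP/powR_eq0_eq0 ->.
    by rewrite !mul0r mulr0.
  rewrite {}E => /(_ _ _)/le_trans; apply.
  - by move=> k; rewrite mulr_ge0 ?powR_ge0.
  - by move=> k; rewrite mulr_ge0 ?powR_ge0.
  rewrite (eq_bigr (fun k => c k `^ p * V k `^ p'^-1)); last first.
    move=> k _; rewrite powRM ?powR_ge0// -powRrM.
    by congr (_ * _ `^ _); field; rewrite pn p'n.
  rewrite ler_wpM2l ?powR_ge0// ge0_ler_powR ?(ltW a'0) ?nnegrE//.
  - by apply: sumr_ge0 => *; apply: powR_ge0.
  - by rewrite mulr_ge0 ?powR_ge0// ltW.
  have := @prefix_sum_powR (fun k => v k `^ p') p'^-1 n.+1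
    (fun k => powR_ge0 _ _) a'0 a'1.
  rewrite invrK ppV; apply: le_trans.
  rewrite le_eqVlt; apply/orP; left; apply/eqP; apply: eq_bigr => k _.
  by rewrite powRM ?powR_ge0// -powRrM; congr (_ * _ `^ _); field; rewrite pn p'n.
(* The outer exponent q becomes r = q / p >= 1 on the sums of d, as required
   for exchanging the sums by Minkowski's inequality. *)
pose r := q / p.
have r1 : 1 <= r by rewrite /r ler_pdivlMr// mul1r.
have rn : r != 0 by rewrite gt_eqF// (lt_le_trans _ r1).
pose d k := c k `^ p * V k `^ p'^-1.
have d0 k : 0 <= d k by rewrite mulr_ge0 ?powR_ge0.
pose s n := u n * V n `^ (q * p'^-1 * p'^-1).
have s0 n : 0 <= s n by rewrite mulr_ge0 ?powR_ge0.
have D0 n : 0 <= \sum_(0 <= k < n.+1) d k by apply: sumr_ge0.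
have H2 n : u n * (\sum_(0 <= k < n.+1) v k * c k) `^ q <=
    p' `^ (q * p'^-1) * (s n * (\sum_(0 <= k < n.+1) d k) `^ r).
  have -> : p' `^ (q * p'^-1) * (s n * (\sum_(0 <= k < n.+1) d k) `^ r) =
     u n * ((\sum_(0 <= k < n.+1) d k) `^ p^-1 * (p' * V n `^ p'^-1) `^ p'^-1) `^ q.
    rewrite powRM ?powR_ge0// -!powRrM powRM ?powR_ge0 ?(ltW p'0)// -powRrM /s /r.
    by rewrite (mulrC p^-1) (mulrC p'^-1 q) (mulrC p'^-1 (q * _)); ring.
  rewrite ler_wpM2l// ge0_ler_powR ?nnegrE ?(ltW q0)//.
    by apply: sumr_ge0 => *; rewrite mulr_ge0.
  by rewrite mulr_ge0 ?powR_ge0.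
(* The hypothesis gives V_n^(1/p') <= B U_n^(-1/q), raised to the power q/p'. *)
have H3 n : (n < L)%N -> s n <= B `^ (q * p'^-1) * (u n * U n `^ (p^-1 - 1)).
  move=> nL; have [Un|Un] := eqVneq (U n) 0.
    have : u n <= 0 by rewrite -Un /U big_ltn// lerDl sumr_ge0.
    rewrite le_eqVlt ltNge u0 orbF => /eqP un.
    by rewrite /s un !mul0r mulr0.
  have Up : 0 < U n by rewrite lt_neqAle eq_sym Un U0.
  rewrite /s mulrCA ler_wpM2l// ppU powRN ler_pdivlMr ?powR_gt0//.
  have -> : V n `^ (q * p'^-1 * p'^-1) * U n `^ p'^-1 =
     (U n `^ q^-1 * V n `^ p'^-1) `^ (q * p'^-1).
    rewrite powRM ?powR_ge0// -!powRrM mulrC.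
    by congr (_ `^ _ * _ `^ _); field; rewrite ?p'n ?qn.
  rewrite ge0_ler_powR ?nnegrE ?mulr_ge0 ?powR_ge0 ?(ltW q0) ?(ltW a'0)//.
  exact: HB.
have H4 k : (\sum_(k <= n < L) s n) `^ r^-1 <=
    (B `^ (q * p'^-1) * (p * U k `^ p^-1)) `^ r^-1.
  rewrite ge0_ler_powR ?nnegrE ?invr_ge0 ?(le_trans _ r1) ?sumr_ge0//.
    by rewrite !mulr_ge0 ?powR_ge0// ltW.
  apply: (@le_trans _ _
      (\sum_(k <= n < L) B `^ (q * p'^-1) * (u n * U n `^ (p^-1 - 1)))).
    rewrite !big_seq; apply: ler_sum => n; rewrite mem_index_iota => /andP[_ nL].
    exact: H3.
  rewrite -mulr_sumr ler_wpM2l ?powR_ge0//.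
  by have := @tail_sum_powR u p^-1 k L u0 a0 a1; rewrite invrK.
(* The exponents of B add up by p / p' + 1 = p. *)
have H5 : (\sum_(0 <= n < L) s n * (\sum_(0 <= k < n.+1) d k) `^ r) `^ r^-1 <=
    B `^ p * p `^ (p / q) * \sum_(0 <= k < L) c k `^ p.
  apply: le_trans (minkowski_prefix L s0 d0 r1) _.
  rewrite mulr_sumr !big_seq; apply: ler_sum => k.
  rewrite mem_index_iota => /andP[_ kL].
  apply: le_trans (ler_wpM2l (d0 k) (H4 k)) _.
  rewrite !powRM ?mulr_ge0 ?powR_ge0 ?(ltW p0)// -!powRrM /d.
  have -> : r^-1 = p / q by rewrite /r invf_div.
  have -> : q * p'^-1 * (p / q) = p * p'^-1 by field; rewrite p'n qn.
  have -> : p^-1 * (p / q) = q^-1 by field; rewrite pn qn.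
  have -> : B `^ p = B `^ (p * p'^-1) * B.
    have [->|Bn] := eqVneq B 0; first by rewrite mulr0 powR0.
    rewrite -[X in _ * X]powRr1// -powRD ?Bn ?implybT//; congr (_ `^ _).
    by rewrite -[X in _ + X](divff pn) -mulrDr addrC pp' mulr1.
  have -> : c k `^ p * V k `^ p'^-1 *
      (B `^ (p * p'^-1) * (p `^ (p / q) * U k `^ q^-1)) =
      (B `^ (p * p'^-1) * p `^ (p / q) * c k `^ p) *
      (U k `^ q^-1 * V k `^ p'^-1) by ring.
  have -> : B `^ (p * p'^-1) * B * p `^ (p / q) * c k `^ p =
     (B `^ (p * p'^-1) * p `^ (p / q) * c k `^ p) * B by ring.
  by rewrite ler_wpM2l ?mulr_ge0 ?powR_ge0//; exact: HB.
set S := \sum_(0 <= n < L) u n * _.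
set S' := \sum_(0 <= n < L) _ * _ in H5.
have S0 : 0 <= S by apply: sumr_ge0 => n _; rewrite mulr_ge0 ?powR_ge0.
have S'0 : 0 <= S' by apply: sumr_ge0 => n _; rewrite mulr_ge0 ?powR_ge0.
have C0 : 0 <= \sum_(0 <= k < L) c k `^ p by apply: sumr_ge0 => *; apply: powR_ge0.
have SS' : S <= p' `^ (q * p'^-1) * S'.
  by rewrite /S /S' mulr_sumr; apply: ler_sum.
apply: (@le_trans _ _ ((p' `^ (q * p'^-1) * S') `^ q^-1)).
  by rewrite ge0_ler_powR ?nnegrE ?mulr_ge0 ?powR_ge0 ?invr_ge0 ?(ltW q0).
rewrite powRM ?powR_ge0// -powRrM.
have -> : q * p'^-1 * q^-1 = p'^-1 by field; rewrite p'n qn.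
have -> : S' `^ q^-1 = (S' `^ r^-1) `^ p^-1.
  by rewrite -powRrM; congr (_ `^ _); rewrite /r; field; rewrite pn qn.
apply: (@le_trans _ _ (p' `^ p'^-1 *
    (B `^ p * p `^ (p / q) * \sum_(0 <= k < L) c k `^ p) `^ p^-1)).
  by rewrite ler_wpM2l ?powR_ge0// ge0_ler_powR ?nnegrE ?(ltW a0)
    ?mulr_ge0 ?powR_ge0.
rewrite !powRM ?mulr_ge0 ?powR_ge0// -!powRrM mulfV// powRr1//.
have -> : p / q * p^-1 = q^-1 by field; rewrite pn qn.
by rewrite le_eqVlt; apply/orP; left; apply/eqP; ring.
Qed.

End discrete_hardy.

Local Open Scope ereal_scope.

(** * Complex-valued functions *)

Section complex_abs.
Context {R : realType}.
Implicit Types z u : R[i].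

Lemma cabs_ge0 z : (0 <= cabs z)%R.
Proof. by case: z => a b; rewrite /cabs/= sqrtr_ge0. Qed.

Lemma cabsM z u : (cabs (z * u) = cabs z * cabs u)%R.
Proof. exact: Normc.normcM. Qed.

Lemma cabsE z : cabs z = Num.sqrt (complex.Re z ^+ 2 + complex.Im z ^+ 2)%R.
Proof. by case: z. Qed.

Lemma cabs_real (r : R) : cabs r%:C%C = `|r|%R.
Proof. by rewrite cabsE/= expr0n addr0 sqrtr_sqr. Qed.

Lemma sqr_cabs z : (cabs z ^+ 2 = complex.Re z ^+ 2 + complex.Im z ^+ 2)%R.
Proof. by rewrite cabsE sqr_sqrtr// addr_ge0// sqr_ge0. Qed.

Lemma normr_Re_le_cabs z : (`|complex.Re z| <= cabs z)%R.
Proof. by rewrite cabsE -sqrtr_sqr ler_wsqrtr// lerDl sqr_ge0. Qed.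

Lemma normr_Im_le_cabs z : (`|complex.Im z| <= cabs z)%R.
Proof. by rewrite cabsE -sqrtr_sqr ler_wsqrtr// lerDr sqr_ge0. Qed.

Lemma cabs_le z : (cabs z <= `|complex.Re z| + `|complex.Im z|)%R.
Proof.
rewrite -ler_sqr ?nnegrE ?cabs_ge0 ?addr_ge0// sqr_cabs sqrrD !real_normK ?num_real//.
by rewrite lerD2r lerDl mulrn_wge0// mulr_ge0.
Qed.

Lemma cauchy_schwarz_cabs z u :
  (complex.Re z * complex.Re u + complex.Im z * complex.Im u <= cabs z * cabs u)%R.
Proof.
have [h|h] := leP (complex.Re z * complex.Re u + complex.Im z * complex.Im u)%R 0%R.
  by rewrite (le_trans h)// mulr_ge0 ?cabs_ge0.
rewrite -ler_sqr ?nnegrE ?mulr_ge0 ?cabs_ge0 ?(ltW h)// exprMn !sqr_cabs.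
rewrite -subr_ge0.
suff -> : ((complex.Re z ^+ 2 + complex.Im z ^+ 2) *
      (complex.Re u ^+ 2 + complex.Im u ^+ 2) -
  (complex.Re z * complex.Re u + complex.Im z * complex.Im u) ^+ 2 =
  (complex.Re z * complex.Im u - complex.Im z * complex.Re u) ^+ 2)%R by exact: sqr_ge0.
by ring.
Qed.

End complex_abs.

Section complex_integral.
Context d (T : measurableType d) (R : realType).
Variable mu : {measure set T -> \bar R}.
Implicit Types (A : set T) (f g : T -> R[i]).

Lemma measurable_cabs g : cmeasurable g -> measurable_fun setT (fun x => cabs (g x)).
Proof.
move=> [mr mi]; apply: (eq_measurable_fun (Num.sqrt \o
    (fun x => complex.Re (g x) ^+ 2 + complex.Im (g x) ^+ 2)%R)).
  by move=> x _; rewrite cabsE.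
apply: measurableT_comp.
  by apply: continuous_measurable_fun; exact: sqrt_continuous.
by apply: measurable_funD; apply: measurable_funX.
Qed.

Lemma cmeasurableM f g : cmeasurable f -> cmeasurable g ->
  cmeasurable (fun x => f x * g x)%R.
Proof.
move=> [fr fi] [gr gi]; split.
  apply: (eq_measurable_fun (fun x => complex.Re (f x) * complex.Re (g x) -
      complex.Im (f x) * complex.Im (g x))%R).
    by move=> x _; case: (f x) => ? ?; case: (g x).
  by apply: measurable_funB; apply: measurable_funM.
apply: (eq_measurable_fun (fun x => complex.Re (f x) * complex.Im (g x) +
    complex.Im (f x) * complex.Re (g x))%R).
  by move=> x _; case: (f x) => ? ?; case: (g x).
by apply: measurable_funD; apply: measurable_funM.
Qed.

Lemma cintegrable_cabs A g : measurable A -> cmeasurable g ->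
  cintegrable mu A g <-> mu.-integrable A (fun x => (cabs (g x))%:E).
Proof.
move=> mA [mr mi]; split => [[ir ii]|ig].
  apply: (@le_integrable _ _ _ mu A mA _
    (fun x => (`|complex.Re (g x)| + `|complex.Im (g x)|)%:E)).
  - by apply/measurable_EFinP; apply: measurable_funTS; exact: measurable_cabs.
  - move=> x _; rewrite lee_fin ger0_norm ?cabs_ge0// ger0_norm ?addr_ge0//.
    exact: cabs_le.
  - under eq_fun do rewrite EFinD.
    by apply: integrableD => //; apply: (integrable_abse (f := fun x => (_ (g x))%:E)).
split.
- apply: le_integrable ig => //.
    by apply/measurable_EFinP; apply: measurable_funTS.
  move=> x _; rewrite lee_fin (ger0_norm (cabs_ge0 _)); exact: normr_Re_le_cabs.
- apply: le_integrable ig => //.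
    by apply/measurable_EFinP; apply: measurable_funTS.
  move=> x _; rewrite lee_fin (ger0_norm (cabs_ge0 _)); exact: normr_Im_le_cabs.
Qed.

(** For z = int_A g, |z|^2 is the integral of the real part of conj(z) g, which
    is pointwise at most |z| |g|. *)
Lemma le_cabs_cintegral A g : measurable A -> cmeasurable g -> cintegrable mu A g ->
  (cabs (cintegral mu A g) <= \int[mu]_(x in A) cabs (g x))%R.
Proof.
move=> mA mg ig; have iN := (cintegrable_cabs mA mg).1 ig.
case: (ig) => ir ii.
have iZ (r : R) (h : T -> R) : mu.-integrable A (EFin \o h) ->
    mu.-integrable A (EFin \o (fun x => r * h x)%R).
  move=> ih; apply: (eq_integrable mA (fun x => r%:E * (h x)%:E)) => //.
  exact: integrableZl.
set z := cintegral mu A g.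
have [z0|z0] := eqVneq (cabs z) 0%R.
  by rewrite z0; apply: Rintegral_ge0 => x _; exact: cabs_ge0.
have zp : (0 < cabs z)%R by rewrite lt_neqAle eq_sym z0 cabs_ge0.
rewrite -(ler_pM2l zp) -expr2 sqr_cabs -RintegralZl// !expr2.
have zr : complex.Re z = (\int[mu]_(x in A) complex.Re (g x))%R by [].
have zi : complex.Im z = (\int[mu]_(x in A) complex.Im (g x))%R by [].
rewrite {2}zr {2}zi -!RintegralZl// -RintegralD//; last 2 first.
- exact: iZ.
- exact: iZ.
apply: le_Rintegral => //.
- apply: (eq_integrable mA (fun x => (complex.Re z * complex.Re (g x))%:E +
      (complex.Im z * complex.Im (g x))%:E)) => //.
  by apply: integrableD => //; exact: iZ.
- exact: iZ.
- by move=> x _; exact: cauchy_schwarz_cabs.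
Qed.

(** If g is not integrable the left-hand side is +oo by convention, and so is
    the integral of |g|. *)
Lemma abs_scaled_cintegral_le (c : R) A g : (0 < c)%R -> measurable A ->
  cmeasurable g ->
  abs_scaled_cintegral mu c A g <= c%:E * \int[mu]_(x in A) (cabs (g x))%:E.
Proof.
move=> c0 mA mg; rewrite /abs_scaled_cintegral; case: asboolP => ig; last first.
  have [I|I] := ltP (\int[mu]_(x in A) (cabs (g x))%:E) +oo; last first.
    by move: I; rewrite leye_eq => /eqP ->; rewrite gt0_muley.
  exfalso; apply: ig; apply/cintegrable_cabs => //; apply/integrableP; split.
    by apply/measurable_EFinP; apply: measurable_funTS; exact: measurable_cabs.
  by under eq_integral do rewrite gee0_abs ?lee_fin ?cabs_ge0//.
have iN := (cintegrable_cabs mA mg).1 ig.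
rewrite cabsM cabs_real gtr0_norm// EFinM lee_pmul2l//.
have := le_cabs_cintegral mA mg ig; rewrite -lee_fin => /le_trans; apply.
by rewrite fineK//; exact: integrable_fin_num.
Qed.

(** For nonnegative g, divergence of the integral and non-integrability are the
    same, so the test functions of the necessity part need no check of
    integrability. *)
Lemma abs_scaled_cintegral_nnegE (c : R) A (g : T -> R) : (0 < c)%R -> measurable A ->
  measurable_fun setT g -> (forall x, 0 <= g x)%R ->
  abs_scaled_cintegral mu c A (fun x => (g x)%:C%C) = c%:E * \int[mu]_(x in A) (g x)%:E.
Proof.
move=> c0 mA mg g0.
have gE x : cabs (g x)%:C%C = g x by rewrite cabs_real ger0_norm.
have mgC : cmeasurable (fun x => (g x)%:C%C) by split => //=; exact: measurable_cst.
rewrite /abs_scaled_cintegral; case: asboolP => ig.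
  have := (cintegrable_cabs mA mgC).1 ig; under eq_fun do rewrite gE.
  move=> iN; rewrite cabsM cabs_real gtr0_norm// EFinM; congr (_ * _).
  have I0 : (0 <= \int[mu]_(x in A) g x)%R by exact: Rintegral_ge0.
  rewrite /cintegral cabsE/=.
  have -> : (\int[mu]_(x in A) 0 = 0)%R by rewrite /Rintegral integral0.
  by rewrite expr0n addr0 sqrtr_sqr ger0_norm// fineK//; exact: integrable_fin_num.
have [I|I] := ltP (\int[mu]_(x in A) (g x)%:E) +oo; last first.
  by move: I; rewrite leye_eq => /eqP ->; rewrite gt0_muley.
exfalso; apply: ig; apply/cintegrable_cabs => //; apply/integrableP; split.
  by apply/measurable_EFinP; apply: measurable_funTS; exact: measurable_cabs.
by under eq_integral do rewrite gE gee0_abs ?lee_fin//.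
Qed.

End complex_integral.

(** * Hoelder's inequality on a block *)

Section hoelder_on.
Context d (T : measurableType d) (R : realType).
Variable mu : {measure set T -> \bar R}.
Implicit Types (A : set T) (f g : T -> R[i]).

Lemma Lnorm_on_ge0 p A g : 0 <= Lnorm_on mu p A g.
Proof. exact: Lnorm_ge0. Qed.

Lemma Lnorm_onE (p : R) A g : (0 < p)%R ->
  Lnorm_on mu p%:E A g = (\int[mu]_(x in A) (cabs (g x) `^ p)%:E) `^ p^-1.
Proof.
move=> p0; rewrite /Lnorm_on unlock [in RHS]integral_mkcond; congr (_ `^ _).
apply: eq_integral => x _; rewrite !patchE; case: ifPn => _; last first.
  by rewrite abse0 poweR0r ?gt_eqF.
by rewrite gee0_abs ?lee_fin ?cabs_ge0// poweR_EFin.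
Qed.

Lemma ae_le_Lnorm_infty (F : T -> \bar R) : \forall x \ae mu, `|F x| <= 'N[mu]_+oo[F].
Proof.
rewrite unlock /Lnorm; case: ifPn => [_|]; first exact: ess_sup_ge.
rewrite -leNgt => mu0; exists setT; split => //.
by apply/eqP; rewrite eq_le mu0/=.
Qed.

Lemma hoelder_infty (F G : T -> \bar R) :
  measurable_fun setT F -> measurable_fun setT G ->
  \int[mu]_x (`|F x| * `|G x|) <= 'N[mu]_+oo[F] * 'N[mu]_1[G].
Proof.
move=> mF mG; rewrite Lnorm1 -ge0_integralZl//;
  [|exact: measurableT_comp|exact: Lnorm_ge0].
apply: ae_ge0_le_integral => //.
- by apply: emeasurable_funM; exact: measurableT_comp.
- by move=> x _; apply: mule_ge0 => //; exact: Lnorm_ge0.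
- by apply: emeasurable_funM => //; exact: measurableT_comp.
- by apply: filterS (ae_le_Lnorm_infty F) => x Fx _; rewrite lee_wpmul2r.
Qed.

(* |g| cut off outside A, so that Hoelder's inequality on the whole space
   becomes the one on A. *)
Let absR A g : T -> R := (fun x => cabs (g x)) \_ A.

Let LnormR p A g : Lnorm_on mu p A g = 'N[mu]_p[EFin \o absR A g].
Proof. by rewrite /Lnorm_on -restrict_EFin. Qed.

Let absR_ge0 A g x : (0 <= absR A g x)%R.
Proof. by rewrite /absR patchE; case: ifP => // _; exact: cabs_ge0. Qed.

Let measurable_absR A g : measurable A -> cmeasurable g ->
  measurable_fun setT (absR A g).
Proof.
move=> mA mg; apply/(measurable_restrictT _ mA).1.
by apply: measurable_funTS; exact: measurable_cabs.
Qed.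

Lemma hoelder_on p A f g : 1 <= p -> measurable A -> cmeasurable f -> cmeasurable g ->
  \int[mu]_(x in A) (cabs (g x * f x))%:E <=
  Lnorm_on mu (hoelder_conjugate p) A g * Lnorm_on mu p A f.
Proof.
move=> p1 mA mf mg.
have E : \int[mu]_(x in A) (cabs (g x * f x))%:E =
    \int[mu]_x (absR A g x * absR A f x)%:E.
  rewrite [LHS]integral_mkcond; apply: eq_integral => x _.
  by rewrite /absR !patchE; case: ifP => // _; rewrite ?cabsM// mulr0.
rewrite E !LnormR; have mF := measurable_absR mA mf; have mG := measurable_absR mA mg.
have Eabs : \int[mu]_x (absR A g x * absR A f x)%:E =
  \int[mu]_x (`|(EFin \o absR A g) x| * `|(EFin \o absR A f) x|).
  by apply: eq_integral => x _; rewrite /= !ger0_norm ?absR_ge0.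
case: p p1 => [p||//]; last first.
  move=> _; rewrite hoelder_conjugatey muleC Eabs; under eq_integral do rewrite muleC.
  by apply: hoelder_infty; apply/measurable_EFinP.
rewrite lee_fin le_eqVlt => /predU1P[<-|p1].
  by rewrite hoelder_conjugate1 Eabs; apply: hoelder_infty; apply/measurable_EFinP.
have p0 : (0 < p)%R by exact: lt_trans p1.
have p10 : (0 < p - 1)%R by rewrite subr_gt0.
have -> : hoelder_conjugate p%:E = (p / (p - 1))%:E.
  by rewrite /hoelder_conjugate/= gt_eqF// inver subr_eq0 gt_eqF.
apply: le_trans (hoelder mu mG mF _ p0 _).
- rewrite Lnorm1; apply: ge0_le_integral => //.
  + by move=> x _; rewrite lee_fin mulr_ge0.
  + by apply/measurable_EFinP; apply: measurable_funM.
  + by apply: measurableT_comp => //; apply/measurable_EFinP; apply: measurable_funM.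
  + by move=> x _; rewrite lee_fin ler_norm.
- by rewrite divr_gt0.
- by rewrite invf_div; field; rewrite gt_eqF.
Qed.

End hoelder_on.

(** * Weighted sequences *)

Section exponents.
Context {R : realType}.

Lemma hoelder_conjugate_fin (p : R) : (1 < p)%R ->
  hoelder_conjugate p%:E = (p / (p - 1))%:E.
Proof.
move=> p1; have p0 : (0 < p)%R := lt_trans ltr01 p1.
by rewrite /hoelder_conjugate/= gt_eqF// inver subr_eq0 gt_eqF.
Qed.

Lemma hoelder_conj_gt0 (p : R) : (1 < p)%R -> (0 < p / (p - 1))%R.
Proof. by move=> p1; rewrite divr_gt0 ?subr_gt0// (lt_trans ltr01). Qed.

Lemma hoelder_conj_sum1 (p : R) : (1 < p)%R -> (p^-1 + (p / (p - 1))^-1 = 1)%R.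
Proof. by move=> p1; rewrite invf_div; field; rewrite gt_eqF// (lt_trans ltr01). Qed.

Lemma lee_poweR (x y : \bar R) (r : R) : (0 <= r)%R -> 0 <= x -> x <= y ->
  x `^ r <= y `^ r.
Proof.
move=> r0 x0 xy; apply: gt0_ler_poweR => //.
  by rewrite in_itv/= x0 leey.
by rewrite in_itv/= (le_trans x0 xy) leey.
Qed.

Lemma poweR_le_root (x : \bar R) (c r : R) : (0 < r)%R -> 0 <= x -> (0 <= c)%R ->
  x <= (c `^ r)%:E -> x `^ r^-1 <= c%:E.
Proof.
move=> r0 x0 c0 h; apply: (le_trans (lee_poweR _ x0 h)); first by rewrite invr_ge0 ltW.
by rewrite poweR_EFin powRKV// gt_eqF.
Qed.

End exponents.

Section sequences.
Context {R : realType}.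
Implicit Types (p q : \bar R) (b M : nat -> R) (w a x : nat -> \bar R).

Lemma lee_sum_term (F : nat -> \bar R) k n : (forall i, 0 <= F i) -> (k < n)%N ->
  F k <= \sum_(0 <= i < n) F i.
Proof.
move=> F0 kn; rewrite (bigD1_seq k) ?iota_uniq ?mem_index_iota//=.
by rewrite leeDl// sume_ge0.
Qed.

(** The shape shared by the two sides of the inequality: [hardy_lhs] is this norm
    of the averages, and [hardy_rhs] dominates this norm of the block norms. *)
Definition wlnorm q b x : \bar R :=
  match q with
  | q%:E => (\sum_(0 <= n <oo) (b n)%:E * x n `^ q) `^ q^-1
  | _ => ereal_sup [set x n | n in [set n | (0 < b n)%R]]
  end.

Lemma wlnorm_ge0 q b x : (forall n, (0 < b n)%R) -> (forall n, 0 <= x n) ->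
  0 <= wlnorm q b x.
Proof.
move=> b0 x0; case: q => [q||] /=; first exact: poweR_ge0.
- by apply: (le_trans (x0 0%N)); apply: ereal_sup_ubound; exists 0%N => //=.
- by apply: (le_trans (x0 0%N)); apply: ereal_sup_ubound; exists 0%N => //=.
Qed.

Lemma wlnorm_fin_le (q : R) b x (t : nat -> R) (c : R) : (0 < q)%R ->
  (forall n, (0 < b n)%R) -> (forall n, 0 <= x n) -> (forall n, x n <= (t n)%:E) ->
  (0 <= c)%R ->
  (forall L, (\sum_(0 <= n < L) b n * t n `^ q) `^ q^-1 <= c)%R ->
  wlnorm q%:E b x <= c%:E.
Proof.
move=> q0 b0 x0 xt c0 H.
have t0 n : (0 <= t n)%R by rewrite -lee_fin (le_trans (x0 n)).
have u0 n : 0 <= (b n)%:E * x n `^ q by rewrite mule_ge0 ?poweR_ge0 ?lee_fin ?ltW.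
rewrite /wlnorm; apply: poweR_le_root => //; first by apply: nneseries_ge0 => n _ _.
apply: lime_le; first by apply: is_cvg_nneseries => n _ _.
apply: nearW => L; apply: (@le_trans _ _ (\sum_(0 <= n < L) (b n * t n `^ q)%:E)).
  apply: lee_sum => n _; rewrite EFinM lee_pmul2l ?lte_fin//.
  by rewrite -poweR_EFin lee_poweR// ltW.
rewrite sumEFin lee_fin.
have S0 : (0 <= \sum_(0 <= n < L) b n * t n `^ q)%R.
  by apply: sumr_ge0 => n _; rewrite mulr_ge0 ?powR_ge0// ltW.
rewrite -[leLHS](@powRVK _ _ q) ?gt_eqF//.
by rewrite ge0_ler_powR ?nnegrE ?powR_ge0 ?(ltW q0)//; exact: H.
Qed.

(** Used to see that every entry is finite when the norm is. *)
Lemma wlnorm_term p b x k : 1 <= p ->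
  (forall n, (0 < b n)%R) -> (forall n, 0 <= x n) ->
  exists2 c : R, (0 < c)%R & c%:E * x k <= wlnorm p b x.
Proof.
move=> p1 b0 x0; case: p p1 => [p||//]; last first.
  by exists 1%R; rewrite ?mul1e// ; apply: ereal_sup_ubound; exists k => //=.
rewrite lee_fin => p1; have p0 : (0 < p)%R := lt_le_trans ltr01 p1.
exists (b k `^ p^-1)%R; first exact: powR_gt0.
have u0 n : 0 <= (b n)%:E * x n `^ p by rewrite mule_ge0 ?poweR_ge0 ?lee_fin ?ltW.
have -> : (b k `^ p^-1)%:E * x k = ((b k)%:E * x k `^ p) `^ p^-1.
  rewrite poweRM ?poweR_ge0 ?lee_fin ?ltW// -poweRrM mulfV ?gt_eqF//.
  by rewrite poweRe1// poweR_EFin.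
apply: lee_poweR => //; first by rewrite invr_ge0 ltW.
rewrite (@nneseriesD1 _ _ k)//.
by rewrite leeDl// nneseries_ge0.
Qed.

Lemma wlnorm_partial (p : R) b (x : nat -> R) L : (0 < p)%R ->
  (forall n, (0 < b n)%R) -> (forall n, (0 <= x n)%R) ->
  ((\sum_(0 <= k < L) (b k `^ p^-1 * x k) `^ p) `^ p^-1)%:E <=
  wlnorm p%:E b (fun k => (x k)%:E).
Proof.
move=> p0 b0 x0; rewrite -poweR_EFin; apply: lee_poweR.
- by rewrite invr_ge0 ltW.
- by rewrite lee_fin; apply: sumr_ge0 => *; exact: powR_ge0.
apply: (@le_trans _ _ (\sum_(0 <= n < L) (b n)%:E * (x n)%:E `^ p)); last first.
  by apply: nneseries_lim_ge => n _ _; rewrite mule_ge0 ?poweR_ge0 ?lee_fin ?ltW.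
rewrite -sumEFin lee_sum// => k _.
by rewrite powRM ?powR_ge0// powRVK ?gt_eqF ?(ltW (b0 k))// EFinM poweR_EFin.
Qed.

Lemma beta_left_partial (q : R) b M N L : (0 < q)%R -> (forall n, (0 < b n)%R) ->
  ((\sum_(N <= n < L) b n / M n `^ q) `^ q^-1)%:E <= beta_left q%:E b M N.
Proof.
move=> q0 b0; rewrite /beta_left -poweR_EFin; apply: lee_poweR.
- by rewrite invr_ge0 ltW.
- by rewrite lee_fin; apply: sumr_ge0 => *; rewrite divr_ge0 ?powR_ge0 ?ltW.
rewrite -sumEFin; apply: nneseries_lim_ge => n _ _.
by rewrite lee_fin divr_ge0 ?powR_ge0 ?ltW.
Qed.

Lemma beta_left_gt0 q b M N : 1 <= q ->
  (forall n, (0 < b n)%R) -> (forall n, (0 < M n)%R) ->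
  0 < beta_left q b M N.
Proof.
move=> q1 b0 M0; case: q q1 => [q||//]; last first.
  move=> _; apply: (@lt_le_trans _ _ (M N)^-1%:E); first by rewrite lte_fin invr_gt0.
  by apply: ereal_sup_ubound; exists N => //=.
rewrite lee_fin => q1; have q0 : (0 < q)%R := lt_le_trans ltr01 q1.
apply: lt_le_trans (beta_left_partial M N N.+1 q0 b0).
by rewrite lte_fin big_nat1 powR_gt0// divr_gt0// powR_gt0.
Qed.

Lemma beta_right_ge0 p b w N : (forall n, (0 < b n)%R) -> (forall n, 0 <= w n) ->
  0 <= beta_right p b w N.
Proof.
move=> b0 w0; case: p => [p||] /=; [|by apply: sume_ge0|by apply: sume_ge0].
case: ifP => _; last exact: poweR_ge0.
exact: bigmax_ge_id.
Qed.

(** Used to see that w_k is finite, or zero, when the second factor of beta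
    is. *)
Lemma beta_right_term p b w k : 1 <= p ->
  (forall n, (0 < b n)%R) -> (forall n, 0 <= w n) ->
  exists2 c : R, (0 < c)%R & forall N, (k <= N)%N -> c%:E * w k <= beta_right p b w N.
Proof.
move=> p1 b0 w0; case: p p1 => [p||//]; last first.
  move=> _; exists 1%R => // N kN; rewrite mul1e /beta_right.
  exact: lee_sum_term.
rewrite lee_fin le_eqVlt => /predU1P[<-|p1].
  exists (b k)^-1%R; first by rewrite invr_gt0.
  move=> N kN; rewrite /beta_right eqxx muleC.
  apply: (le_bigmax_seq _ k xpredT (fun k => w k * ((b k)^-1)%:E)) => //.
  by rewrite mem_index_iota.
rewrite /beta_right gt_eqF// hoelder_conjugate_fin//=.
set p' := (p / (p - 1))%R; have p'0 : (0 < p')%R by exact: hoelder_conj_gt0.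
exists ((b k `^ (p' / p))^-1 `^ p'^-1)%R; first by rewrite powR_gt0// invr_gt0 powR_gt0.
move=> N kN.
have u0 n : 0 <= w n `^ p' * ((b n `^ (p' / p))^-1)%:E.
  by rewrite mule_ge0 ?poweR_ge0// lee_fin invr_ge0 powR_ge0.
apply: (@le_trans _ _ ((w k `^ p' * ((b k `^ (p' / p))^-1)%:E) `^ p'^-1)).
  rewrite poweRM ?poweR_ge0// ?lee_fin ?invr_ge0 ?powR_ge0//.
  by rewrite -poweRrM mulfV ?gt_eqF// poweRe1// poweR_EFin muleC.
apply: lee_poweR => //; first by rewrite invr_ge0 ltW.
exact: (@lee_sum_term (fun k => w k `^ p' * ((b k `^ (p' / p))^-1)%:E)).
Qed.

(** In this range the second factor of beta is the l^p'-norm of the normalised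
    weights v_k = w_k / b_k^(1/p). *)
Lemma beta_right_gt1 (p : R) b (w : nat -> R) N : (1 < p)%R ->
  (forall n, (0 < b n)%R) -> (forall n, (0 <= w n)%R) ->
  beta_right p%:E b (fun k => (w k)%:E) N =
  ((\sum_(0 <= k < N.+1) (w k / b k `^ p^-1) `^ (p / (p - 1))) `^ (p / (p - 1))^-1)%:E.
Proof.
move=> p1 b0 w0; have p0 : (0 < p)%R := lt_trans ltr01 p1.
rewrite /beta_right gt_eqF// hoelder_conjugate_fin//=.
rewrite -poweR_EFin; congr (_ `^ _); rewrite -sumEFin; apply: eq_bigr => k _.
rewrite ?poweR_EFin -EFinM; congr EFin.
rewrite powRM ?invr_ge0 ?powR_ge0//; congr (_ * _)%R.
rewrite -!powRN -powRrM; congr (_ `^ _)%R.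
by rewrite mulNr mulrC.
Qed.

Lemma beta_ge p q b M w N :
  beta_left q b M N * beta_right p b w N <= hardy_beta p q b M w.
Proof. by apply: ereal_sup_ubound; exists N. Qed.

Lemma hardy_const_gt0 p q : 1 <= p -> p <= q -> (0 < hardy_const p q)%R.
Proof.
move=> p1 pq; rewrite /hardy_const mulr_gt0//.
  case: q pq => [q||]//; case: p p1 => [p||]//=.
  by rewrite lee_fin => p1 _; rewrite powR_gt0// (lt_le_trans ltr01).
have := hoelder_conj_ge1 p1; case: (hoelder_conjugate p) => // p'.
by rewrite lee_fin => p1'; rewrite powR_gt0// (lt_le_trans ltr01).
Qed.

Lemma hardy_const_ge1 p : 1 <= p -> (1 <= hardy_const p +oo)%R.
Proof.
move=> p1; rewrite /hardy_const mul1r.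
have := hoelder_conj_ge1 p1; case: (hoelder_conjugate p) => // p'.
rewrite lee_fin => p1'; rewrite -[leLHS](@powRr0 _ p') ler_powR// invr_ge0.
exact: le_trans p1'.
Qed.

(** Hoelder's inequality for the pairing of (w_k / b_k^(1/p)) and
    (b_k^(1/p) a_k), the two end cases p = 1 and p = +oo included. *)
Lemma sum_le_beta_right p b (w a : nat -> R) (r : R) N : 1 <= p ->
  (forall n, (0 < b n)%R) -> (forall n, (0 <= w n)%R) -> (forall n, (0 <= a n)%R) ->
  wlnorm p b (fun k => (a k)%:E) = r%:E ->
  (\sum_(0 <= k < N.+1) w k * a k)%:E <=
    beta_right p b (fun k => (w k)%:E) N * r%:E.
Proof.
move=> p1 b0 w0 a0; case: p p1 => [p||//]; last first.
  move=> _ rE; rewrite /beta_right sumEFin -EFinM lee_fin mulr_suml.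
  apply: ler_sum => k _; rewrite ler_wpM2l//.
  by rewrite -lee_fin -rE; apply: ereal_sup_ubound; exists k => /=.
rewrite lee_fin le_eqVlt => /predU1P[<-|p1] rE.
  have br0 : 0 <= beta_right 1%:E b (EFin \o w) N.
    by apply: beta_right_ge0 => // n; rewrite lee_fin.
  have := wlnorm_partial N.+1 ltr01 b0 a0; rewrite rE.
  rewrite invr1 powRr1; last by apply: sumr_ge0 => *; exact: powR_ge0.
  move=> /(lee_wpmul2l br0); apply: le_trans.
  rewrite -2!sumEFin ge0_sume_distrr; last by move=> k _; rewrite lee_fin powR_ge0.
  rewrite !big_seq; apply: lee_sum => k; rewrite mem_index_iota => /andP[_ kN].
  rewrite !powRr1 ?mulr_ge0 ?powR_ge0 ?(ltW (b0 k))//.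
  have -> : (w k * a k)%:E = (w k * (b k)^-1)%:E * (b k * a k)%:E.
    by rewrite -EFinM mulrA divfK// gt_eqF.
  apply: lee_wpmul2r; first by rewrite lee_fin mulr_ge0// ltW.
  rewrite /beta_right eqxx.
  apply: (le_bigmax_seq _ k xpredT (fun k => (w k)%:E * ((b k)^-1)%:E)) => //.
  by rewrite mem_index_iota.
have p0 : (0 < p)%R := lt_trans ltr01 p1.
have := wlnorm_partial N.+1 p0 b0 a0; rewrite rE => h.
rewrite beta_right_gt1//.
apply: le_trans (lee_wpmul2l _ h); last by rewrite lee_fin powR_ge0.
rewrite -EFinM lee_fin mulrC.
apply: le_trans (hoelder_sum _ _ _ _ p0
  (hoelder_conj_gt0 p1) (hoelder_conj_sum1 p1)); last 2 first.
- by move=> k; rewrite mulr_ge0 ?powR_ge0.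
- by move=> k; rewrite divr_ge0 ?powR_ge0.
apply: ler_sum => k _.
by rewrite [leRHS]mulrC mulrA divfK// gt_eqF// powR_gt0.
Qed.

(** The case where all the data are finite.  For q = +oo the bound is
    [sum_le_beta_right] term by term, for p = 1 it is [minkowski_prefix], and
    for 1 < p <= q < +oo it is [discrete_hardy] with the normalised weights. *)
Lemma hardy_sequence_fin p q b M (w a : nat -> R) (B r : R) (x : nat -> \bar R) :
  1 <= p -> p <= q -> (forall n, (0 < b n)%R) -> (forall n, (0 < M n)%R) ->
  (forall n, (0 <= w n)%R) -> (forall n, (0 <= a n)%R) ->
  hardy_beta p q b M (fun k => (w k)%:E) = B%:E ->
  wlnorm p b (fun k => (a k)%:E) = r%:E ->
  (forall n, 0 <= x n) ->
  (forall n, x n <= ((M n)^-1 * \sum_(0 <= k < n.+1) w k * a k)%:E) ->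
  wlnorm q b x <= (hardy_const p q * B * r)%:E.
Proof.
move=> p1 pq b0 M0 w0 a0 BE rE x0 xt.
have q1 : 1 <= q := le_trans p1 pq.
have r0 : (0 <= r)%R.
  by rewrite -lee_fin -rE; apply: wlnorm_ge0 => // n; rewrite lee_fin.
have br0 N : 0 <= beta_right p b (EFin \o w) N.
  by apply: beta_right_ge0 => // n; rewrite lee_fin.
have B0 : (0 <= B)%R.
  rewrite -lee_fin -BE; apply: le_trans (beta_ge p q b M _ 0).
  by apply: mule_ge0; [apply/ltW/beta_left_gt0|exact: br0].
have K0 := hardy_const_gt0 p1 pq.
have KBr : (0 <= hardy_const p q * B * r)%R.
  exact: (mulr_ge0 (mulr_ge0 (ltW K0) B0) r0).
case: q q1 pq BE KBr {K0} => [q||//] q1 pq BE KBr; last first.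
  apply: ge_ereal_sup => _ [n _ <-]; apply: le_trans (xt n) _.
  apply: (@le_trans _ _ (B * r)%:E); last first.
    by rewrite lee_fin ler_wpM2r// ler_peMl// hardy_const_ge1.
  have h := sum_le_beta_right n p1 b0 w0 a0 rE.
  rewrite EFinM; apply: (@le_trans _ _ ((M n)^-1%:E *
      (beta_right p b (fun k => (w k)%:E) n * r%:E))).
    by apply: lee_wpmul2l => //; rewrite lee_fin invr_ge0 ltW.
  rewrite muleA EFinM; apply: lee_wpmul2r => //.
  rewrite -BE; apply: le_trans (beta_ge p _ b M _ n).
  apply: lee_wpmul2r => //.
  by apply: ereal_sup_ubound; exists n => /=.
have q0 : (0 < q)%R by rewrite -lte_fin; exact: lt_le_trans q1.
apply: (wlnorm_fin_le q0 b0 x0 xt KBr) => L.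
pose u n := (b n / M n `^ q)%R.
have u0 n : (0 <= u n)%R by rewrite divr_ge0 ?powR_ge0 ?(ltW (b0 n)).
have -> : (\sum_(0 <= n < L) b n * ((M n)^-1 * \sum_(0 <= k < n.+1) w k * a k) `^ q =
    \sum_(0 <= n < L) u n * (\sum_(0 <= k < n.+1) w k * a k) `^ q)%R.
  apply: eq_bigr => n _; rewrite powRM ?invr_ge0 ?(ltW (M0 n))//; last first.
    by apply: sumr_ge0 => k _; rewrite mulr_ge0.
  rewrite mulrA; congr (_ * _ * _)%R.
  by rewrite -powR_inv1 ?(ltW (M0 n))// -powRrM mulN1r powRN.
have left_le N : ((\sum_(N <= n < L) u n) `^ q^-1)%:E <= beta_left q%:E b M N.
  exact: beta_left_partial.
case: p p1 pq BE rE KBr br0 => [p|//|//] p1 pq BE rE KBr br0.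
move: p1; rewrite lee_fin le_eqVlt => /predU1P[p1|p1].
  rewrite -{p}p1 in pq BE rE KBr br0 *.
  have -> : hardy_const 1%:E q%:E = 1%R :> R.
    by rewrite /hardy_const hoelder_conjugate1 /= powR1 mulr1.
  rewrite mul1r.
  have d0 k : (0 <= w k * a k)%R by rewrite mulr_ge0.
  apply: le_trans (minkowski_prefix L u0 d0 _) _; first by rewrite -lee_fin.
  have := wlnorm_partial L ltr01 b0 a0; rewrite rE.
  rewrite invr1 powRr1; last by apply: sumr_ge0 => *; exact: powR_ge0.
  rewrite lee_fin => /(ler_wpM2l B0); apply: le_trans.
  rewrite mulr_sumr; apply: ler_sum => k _.
  rewrite !powRr1 ?mulr_ge0 ?powR_ge0 ?(ltW (b0 k))//.
  rewrite mulrA mulrAC; apply: ler_wpM2r => //.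
  rewrite -ler_pdivrMr// -mulrA mulrC mulrAC -mulrA -lee_fin EFinM -BE.
  apply: le_trans (beta_ge _ _ b M _ k); apply: lee_pmul.
  - by rewrite lee_fin powR_ge0.
  - by rewrite lee_fin divr_ge0// ltW.
  - exact: left_le.
  - rewrite /beta_right eqxx.
    apply: (le_bigmax_seq _ k xpredT (fun k => (w k)%:E * ((b k)^-1)%:E)) => //.
    by rewrite mem_index_iota ltnSn.
have p0 : (0 < p)%R := lt_trans ltr01 p1.
have -> : hardy_const p%:E q%:E =
    (p `^ q^-1 * (p / (p - 1)) `^ (p / (p - 1))^-1)%R :> R.
  by rewrite /hardy_const hoelder_conjugate_fin.
pose v k := (w k / b k `^ p^-1)%R.
pose c k := (b k `^ p^-1 * a k)%R.
have v0 k : (0 <= v k)%R by rewrite divr_ge0 ?powR_ge0.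
have c0 k : (0 <= c k)%R by rewrite mulr_ge0 ?powR_ge0.
rewrite (eq_bigr (fun n => u n * (\sum_(0 <= k < n.+1) v k * c k) `^ q)%R); last first.
  move=> n _; congr (_ * _ `^ _)%R; apply: eq_bigr => k _.
  by rewrite /v /c mulrA divfK// gt_eqF// powR_gt0.
have HB N : (N < L)%N -> ((\sum_(N <= n < L) u n) `^ q^-1 *
     (\sum_(0 <= k < N.+1) v k `^ (p / (p - 1))) `^ (p / (p - 1))^-1 <= B)%R.
  move=> _; rewrite -lee_fin EFinM -BE.
  apply: le_trans (beta_ge _ _ b M _ N).
  rewrite beta_right_gt1//; apply: lee_wpmul2r; first by rewrite lee_fin powR_ge0.
  exact: left_le.
apply: le_trans (discrete_hardy p0 (hoelder_conj_gt0 p1)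
  (hoelder_conj_sum1 p1) _ u0 v0 c0 B0 HB) _.
  by rewrite -lee_fin.
rewrite ler_wpM2l ?mulr_ge0 ?powR_ge0//.
by rewrite -lee_fin -rE; exact: wlnorm_partial.
Qed.

(** Reduction to finite data.  The first factor of beta is positive, so
    beta < +oo forces every w_k to be finite, and beta = 0 forces every w_k to
    be 0.  In the latter case both sides vanish, even when the norm of a is
    +oo; in the other cases an infinite norm of a makes the right-hand side
    infinite. *)
Theorem hardy_sequence p q b M w a x :
  1 <= p -> p <= q -> (forall n, (0 < b n)%R) -> (forall n, (0 < M n)%R) ->
  (forall n, 0 <= w n) -> (forall n, 0 <= a n) ->
  hardy_beta p q b M w < +oo -> (forall n, 0 <= x n) ->
  (forall n, x n <= (M n)^-1%:E * \sum_(0 <= k < n.+1) w k * a k) ->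
  wlnorm q b x <= (hardy_const p q)%:E * hardy_beta p q b M w * wlnorm p b a.
Proof.
move=> p1 pq b0 M0 w0 a0 By x0 xt.
have q1 : 1 <= q := le_trans p1 pq.
have bl0 N := beta_left_gt0 N q1 b0 M0.
have br0 N : 0 <= beta_right p b w N by exact: beta_right_ge0.
have B0 : 0 <= hardy_beta p q b M w.
  by apply: le_trans (beta_ge p q b M _ 0); apply: mule_ge0; [exact/ltW|].
have K0 := hardy_const_gt0 p1 pq.
have [BE|BN0] := eqVneq (hardy_beta p q b M w) 0.
  have w_eq0 k : w k = 0.
    have [c c0 /(_ k (leqnn k)) h] := beta_right_term k p1 b0 w0.
    have : beta_right p b w k = 0.
      apply/eqP; rewrite eq_le br0 andbT leNgt; apply/negP => brk.
      have := beta_ge p q b M w k; rewrite BE leNgt mule_gt0//.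
    move=> E; move: h; rewrite E => h; apply/eqP; rewrite eq_le w0 andbT.
    by move: h; rewrite pmule_rle0 ?lte_fin.
  have x_eq0 n : x n <= (0%R : R)%:E.
    apply: le_trans (xt n) _; rewrite big1 ?mule0// => k _.
    by rewrite w_eq0 mul0e.
  rewrite BE mule0 mul0e.
  case: q {BE By bl0 B0 K0} q1 pq => [q||//] q1 pq; last first.
    by apply: ge_ereal_sup => _ [n _ <-].
  have q0 : (0 < q)%R by rewrite -lte_fin; exact: lt_le_trans q1.
  apply: (@wlnorm_fin_le q b x (fun=> 0%R) 0%R) => // L.
  rewrite big1 ?powR0 ?invr_eq0 ?gt_eqF// => n _.
  by rewrite mulr0.
have BP : 0 < hardy_beta p q b M w by rewrite lt0e BN0.
have [aE|aN] := eqVneq (wlnorm p b a) +oo.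
  by rewrite aE gt0_muley ?leey// mule_gt0// lte_fin.
have afin : wlnorm p b a < +oo by rewrite ltey.
have w_fin k : w k \is a fin_num.
  rewrite ge0_fin_numE// ltNge leye_eq; apply/negP => /eqP wk.
  have [c c0 /(_ k (leqnn k)) h] := beta_right_term k p1 b0 w0.
  move: h; rewrite wk gt0_muley ?lte_fin// leye_eq => /eqP h.
  have := beta_ge p q b M w k; rewrite h gt0_muley// leye_eq => /eqP E.
  by move: By; rewrite E.
have a_fin k : a k \is a fin_num.
  rewrite ge0_fin_numE// ltNge leye_eq; apply/negP => /eqP ak.
  have [c c0 h] := wlnorm_term k p1 b0 a0.
  move: h; rewrite ak gt0_muley ?lte_fin// leye_eq => /eqP h.
  by move: afin; rewrite h.
have wE : w = (fun k => (fine (w k))%:E) by apply/funext => k; rewrite fineK.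
have aE : a = (fun k => (fine (a k))%:E) by apply/funext => k; rewrite fineK.
have Bf : hardy_beta p q b M w \is a fin_num by rewrite ge0_fin_numE.
have af : wlnorm p b a \is a fin_num by rewrite ge0_fin_numE// wlnorm_ge0.
have := @hardy_sequence_fin p q b M (fine \o w) (fine \o a)
  (fine (hardy_beta p q b M w)) (fine (wlnorm p b a)) x p1 pq b0 M0.
rewrite !EFinM !fineK//; apply => //.
- by move=> n; apply: fine_ge0.
- by move=> n; apply: fine_ge0.
- by rewrite -[X in hardy_beta _ _ _ _ X]wE.
- by rewrite -[X in wlnorm _ _ X]aE.
- move=> n; apply: le_trans (xt n) _; rewrite EFinM.
  rewrite -sumEFin; apply: lee_wpmul2l; first by rewrite lee_fin invr_ge0 ltW.
  by apply: lee_sum => k _; rewrite EFinM /= !fineK.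
Qed.

End sequences.

(** * Semi-finite measures *)

Section semifinite_exhaustion.
Context d (T : measurableType d) (R : realType).
Variable mu : {measure set T -> \bar R}.
Hypothesis smu : semifinite mu.

Lemma semifinite_gt0_subset E : measurable E -> 0 < mu E ->
  exists A, [/\ measurable A, A `<=` E & 0 < mu A < +oo].
Proof.
move=> mE E0; have [Ey|Ey] := eqVneq (mu E) +oo; first exact: smu.
by exists E; split => //; rewrite E0 ltey.
Qed.

(** Let s be the supremum of the measures of the subsets of E of finite measure.
    If s were finite, a countable union H of such subsets would have measure s;
    the rest of E still has infinite measure, and adding to H a piece of it of
    positive finite measure would exceed s. *)
Lemma semifinite_large_subset E (K : R) : measurable E -> mu E = +oo ->
  exists A, [/\ measurable A, A `<=` E & K%:E < mu A < +oo].
Proof.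
move=> mE Ey.
pose S := [set mu A | A in [set A | [/\ measurable A, A `<=` E & mu A < +oo]]].
have ub A : measurable A -> A `<=` E -> mu A < +oo -> mu A <= ereal_sup S.
  by move=> mA AE Ay; apply: ereal_sup_ubound; exists A.
have [Sy|Sy] := ltP (ereal_sup S) +oo; last first.
  have : K%:E < ereal_sup S by rewrite (lt_le_trans _ Sy)// ltry.
  move=> /ereal_sup_gt[_ [A [mA AE Ay] <-]] KA.
  by exists A; rewrite KA Ay.
exfalso.
have S0 : S != set0.
  by apply/set0P; exists (mu set0); exists set0 => //=; split => //; rewrite measure0.
have [u uS us] := ereal_sup_seq S0.
have /choice[F FP] : forall n, exists A,
    [/\ measurable A, A `<=` E & mu A < +oo] /\ mu A = u n.
  by move=> n; have [A ? <-] := uS n; exists A.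
pose G n := \big[setU/set0]_(i < n) F i.
have GP n : [/\ measurable (G n), G n `<=` E & mu (G n) < +oo].
  rewrite /G; elim: n => [|n [mG GE Gy]].
    by rewrite big_ord0; split => //; rewrite measure0.
  have [[mF FE Fy] _] := FP n.
  rewrite big_ord_recr/=; split; first exact: measurableU.
    by rewrite subUset.
  by rewrite (le_lt_trans (measureU2 _ _ _))// lte_add_pinfty.
pose H := \bigcup_n G n.
have mH : measurable H by apply: bigcup_measurable => n _; case: (GP n).
have HE : H `<=` E by apply: bigcup_sub => n _; case: (GP n).
have ndG : {homo G : n m / (n <= m)%N >-> (n <= m)%O}.
  by move=> n m nm; rewrite subsetEset; apply: subset_bigsetU.
have Hs : mu H <= ereal_sup S.
  have := nondecreasing_cvg_mu (mu := mu)
    (fun n => let: And3 h _ _ := GP n in h) mH ndG.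
  move=> /[dup] /cvg_lim <- // /cvgP cG; apply: lime_le => //.
  by apply: nearW => n; case: (GP n) => *; exact: ub.
have sH : ereal_sup S <= mu H.
  move/cvg_lim : (us) => <- //; apply: lime_le; first by apply/cvgP: us.
  apply: nearW => n; have [[mF FE Fy] <-] := FP n.
  apply: le_measure; rewrite ?inE// => x Fx.
  by exists n.+1 => //; rewrite /G big_ord_recr; right.
have Hy : mu H < +oo by exact: le_lt_trans Hs Sy.
have EH : mu (E `\` H) = +oo.
  apply/eqP; rewrite eq_le leey/= leNgt; apply/negP => EHy.
  have : mu E < +oo by rewrite (measureDI mu mE mH) setIidr// lte_add_pinfty.
  by rewrite Ey.
have [A [mA AEH /andP[A0 Ay]]] := smu (measurableD mE mH) EH.
have : mu (H `|` A) <= ereal_sup S.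
  apply: ub; first exact: measurableU.
    by rewrite subUset; split => //; apply: subset_trans AEH _; exact: subDsetl.
  by rewrite (le_lt_trans (measureU2 _ _ _))// lte_add_pinfty.
rewrite measureU//; last first.
  by apply/seteqP; split => // x [Hx /AEH[]].
have Hf : mu H \is a fin_num by rewrite ge0_fin_numE.
move=> /le_trans/(_ sH); rewrite -[leRHS]adde0 leeD2lE// leNgt.
by rewrite A0.
Qed.

(** Exhaust the support of h by the sets B_n where h lies between 1/(n+1) and
    n+1, on whose subsets the integral of h is comparable to the measure.
    Either every B_n has finite measure, and then some B_n serves by monotone
    convergence, or some B_n has infinite measure and contains sets of finite
    and arbitrarily large measure. *)
Lemma semifinite_large_integral (h : T -> R) (K : R) :
  measurable_fun setT h -> (forall x, 0 <= h x)%R ->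
  \int[mu]_x (h x)%:E = +oo ->
  exists A, measurable A /\ K%:E < \int[mu]_(x in A) (h x)%:E < +oo.
Proof.
move=> mh h0 hy.
have mhE (D : set T) : measurable_fun D (EFin \o h).
  by apply: measurable_funTS; apply/measurable_EFinP.
pose B n := [set x | n.+1%:R^-1 <= h x <= n.+1%:R]%R.
have mB n : measurable (B n).
  have -> : B n = setT `&` h @^-1` `[n.+1%:R^-1%R, n.+1%:R%R]%classic.
    by rewrite setTI; apply/seteqP; split => x /=; rewrite in_itv.
  by apply: mh => //; exact: measurable_itv.
have ndB : nondecreasing_seq B.
  move=> n m nm; rewrite subsetEset => x /= /andP[h1 h2]; apply/andP; split.
    by apply: le_trans h1; rewrite lef_pV2 ?posrE// ler_nat.
  by apply: le_trans h2 _; rewrite ler_nat.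
have cvgB := ge0_nondecreasing_set_cvg_integral (mu := mu) ndB mB (fun n => mhE (B n))
  (fun n x _ => h0 x : 0 <= (EFin \o h) x).
have Uy : \int[mu]_(x in \bigcup_n B n) (h x)%:E = +oo.
  rewrite -hy integral_mkcond; apply: eq_integral => x _.
  rewrite patchE; case: ifPn => //; rewrite notin_setE => nB.
  have [->//|hx] := eqVneq (h x) 0%R.
  exfalso; apply: nB; have hx0 : (0 < h x)%R by rewrite lt_neqAle eq_sym hx h0.
  pose n := maxn (Num.truncn (h x)) (Num.truncn (h x)^-1).
  exists n => //=; apply/andP; split.
    rewrite -[leRHS]invrK lef_pV2 ?posrE ?invr_gt0//.
    apply: le_trans (ltW (truncnS_gt _)) _.
    by rewrite ler_nat ltnS leq_maxr.
  apply: le_trans (ltW (truncnS_gt _)) _.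
  by rewrite ler_nat ltnS leq_maxl.
rewrite /= Uy in cvgB.
have fin A n : measurable A -> A `<=` B n -> mu A < +oo ->
    \int[mu]_(x in A) (h x)%:E < +oo.
  move=> mA AB Ay; apply: (@le_lt_trans _ _ (\int[mu]_(x in A) (n.+1%:R%:E))).
    apply: ge0_le_integral => //; first by move=> x _; rewrite lee_fin.
    by move=> x /AB/= /andP[_ hn]; rewrite lee_fin.
  by rewrite integral_cst//= lte_mul_pinfty.
have [[n ny]|nB] := pselect (exists n, mu (B n) = +oo).
  have [A [mA AB /andP[KA Ay]]] := semifinite_large_subset (K * n.+1%:R)%R (mB n) ny.
  exists A; split => //; rewrite (fin A n)// andbT.
  apply: (@lt_le_trans _ _ (\int[mu]_(x in A) (n.+1%:R^-1%:E))).
    by rewrite integral_cst//= muleC lte_pdivlMr.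
  apply: ge0_le_integral => //.
  by move=> x /AB/= /andP[hn _]; rewrite lee_fin.
have /cvgeyPgt/(_ K)[n _ /(_ n (leqnn n)) Kn] := cvgB.
exists (B n); split => //; rewrite Kn (fin _ n)//.
by rewrite ltey; apply/eqP => ny; apply: nB; exists n.
Qed.

End semifinite_exhaustion.

(** * Lower bounds for the weighted norm *)

Section wlnorm_lower.
Context {R : realType}.
Implicit Types (q : \bar R) (b M : nat -> R) (x : nat -> \bar R).

(** Keeping the terms of index at least N and factoring V out leaves the first
    factor of beta. *)
Lemma wlnorm_ge q b M x (V : R) N : 1 <= q ->
  (forall n, (0 < b n)%R) -> (forall n, (0 < M n)%R) -> (forall n, 0 <= x n) ->
  (0 <= V)%R -> (forall n, (N <= n)%N -> ((M n)^-1 * V)%:E <= x n) ->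
  beta_left q b M N * V%:E <= wlnorm q b x.
Proof.
move=> q1 b0 M0 x0 V0 Vx.
have [->|VN0] := eqVneq V 0%R; first by rewrite mule0 wlnorm_ge0.
have {VN0} VP : (0 < V)%R by rewrite lt_neqAle eq_sym VN0.
case: q q1 => [q||//] q1; last first.
  rewrite -lee_pdivlMr//; apply: ge_ereal_sup => _ [n /= Nn <-].
  rewrite lee_pdivlMr// -EFinM; apply: le_trans (Vx n Nn) _.
  by apply: ereal_sup_ubound; exists n => /=.
have q0 : (0 < q)%R by rewrite -lte_fin; exact: lt_le_trans q1.
rewrite /beta_left.
have -> : V%:E = (V `^ q)%:E `^ q^-1 by rewrite poweR_EFin powRKV// gt_eqF.
have u0 n : 0 <= (b n / M n `^ q)%:E.
  by rewrite lee_fin divr_ge0 ?powR_ge0 ?(ltW (b0 n)).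
have v0 n : 0 <= (b n)%:E * x n `^ q.
  by rewrite mule_ge0 ?poweR_ge0 ?lee_fin ?(ltW (b0 n)).
rewrite -poweRM; last 2 first.
- exact: nneseries_ge0.
- by rewrite lee_fin powR_ge0.
apply: lee_poweR; first by rewrite invr_ge0 ltW.
  by rewrite mule_ge0 ?nneseries_ge0// lee_fin powR_ge0.
rewrite muleC -nneseriesZl//.
apply: (@le_trans _ _ (\sum_(N <= n <oo) (b n)%:E * x n `^ q)); last first.
  by rewrite (@nneseries_split _ _ 0 N)// add0n leeDr// sume_ge0.
rewrite [leLHS]eseries_cond [leRHS]eseries_cond.
apply: lee_nneseries => n.
  by move=> _ _; rewrite mule_ge0// lee_fin powR_ge0.
move=> Nn; rewrite -EFinM mulrCA EFinM lee_pmul2l ?lte_fin//.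
have -> : (V `^ q / M n `^ q = ((M n)^-1 * V) `^ q)%R.
  rewrite powRM ?invr_ge0 ?(ltW (M0 n)) ?(ltW VP)// mulrC; congr (_ * _)%R.
  by rewrite -[in RHS]powR_inv1 ?(ltW (M0 n))// -powRrM mulN1r powRN.
rewrite -poweR_EFin; apply: lee_poweR; first exact: ltW.
  by rewrite lee_fin mulr_ge0// invr_ge0 ltW.
by apply: Vx; case/andP: Nn.
Qed.

Lemma lee_of_lt_fin (x y : \bar R) : (forall t : R, t%:E < x -> t%:E <= y) -> x <= y.
Proof.
move=> h; rewrite leNgt; apply/negP => yx.
case: x y h yx => [x||] [y||]//= h yx.
- have := h ((y + x) / 2)%R; rewrite lte_fin in yx.
  by rewrite !lte_fin lee_fin !midf_lt// leNgt midf_lt// => /(_ isT).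
- by have := h (x - 1)%R; rewrite lte_fin ltrBlDr ltrDl ltr01 => /(_ isT).
- have := h (y + 1)%R; rewrite ltry lee_fin => /(_ isT).
  by rewrite leNgt ltrDl ltr01.
- by have := h 0%R; rewrite ltry => /(_ isT).
Qed.

End wlnorm_lower.

(** * Sufficiency and test functions *)

Section measure_side.
Context d (T : measurableType d) (R : realType).
Variable mu : {measure set T -> \bar R}.
Variables (X : nat -> set T) (b M : nat -> R) (m : T -> R[i]).
Hypothesis mX : forall n, measurable (X n).
Hypothesis tX : trivIset [set: nat] X.
Hypothesis b0 : forall n, (0 < b n)%R.
Hypothesis M0 : forall n, (0 < M n)%R.
Hypothesis mm : cmeasurable m.
Implicit Types (p q : \bar R) (f : T -> R[i]) (phi : T -> R).

Let Xu n := \bigcup_(k in `I_n.+1) X k.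

Let mXu n : measurable (Xu n).
Proof. by apply: bigcup_measurable. Qed.

Lemma ge0_integral_prefix (h : T -> R) n :
  measurable_fun setT h -> (forall x, 0 <= h x)%R ->
  \int[mu]_(x in Xu n) (h x)%:E = \sum_(0 <= k < n.+1) \int[mu]_(x in X k) (h x)%:E.
Proof.
move=> mh h0; rewrite /Xu bigcup_mkord -(big_mkord xpredT X) ge0_integral_bigsetU//.
- exact: iota_uniq.
- exact: sub_trivIset tX.
- by apply: measurable_funTS; apply/measurable_EFinP.
- by move=> x _; rewrite lee_fin.
Qed.

Let avg f n := abs_scaled_cintegral mu (M n)^-1 (Xu n) (fun x => m x * f x)%R.

Let hardy_lhsE q f : hardy_lhs mu q X b M m f = wlnorm q b (avg f).
Proof. by []. Qed.

Lemma abs_scaled_cintegral_ge0 (c : R) A (g : T -> R[i]) :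
  0 <= abs_scaled_cintegral mu c A g.
Proof.
by rewrite /abs_scaled_cintegral; case: ifP => // _; rewrite lee_fin cabs_ge0.
Qed.

Lemma wlnorm_le_hardy_rhs p f : 1 <= p -> cmeasurable f ->
  wlnorm p b (fun k => Lnorm_on mu p (X k) f) <= hardy_rhs mu p X b f.
Proof.
move=> p1 mf; case: p p1 => [p||//] p1; last first.
  apply: ge_ereal_sup => _ [k /= bk <-].
  rewrite /Lnorm_on unlock; case: ifPn => // _.
  apply: le_ess_sup; apply: nearW => x /=.
  rewrite !patchE; case: ifPn => xk; last by rewrite abse0 abse_ge0.
  rewrite ifT // inE; rewrite inE in xk; by exists k.
have p0 : (0 < p)%R by rewrite -lte_fin; exact: lt_le_trans p1.
rewrite /wlnorm /hardy_rhs le_eqVlt; apply/orP; left; apply/eqP; congr (_ `^ _).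
apply: eq_eseriesr => k _; congr (_ * _).
rewrite Lnorm_onE// -poweRrM mulVf ?gt_eqF// poweRe1//.
by apply: integral_ge0 => x _; rewrite lee_fin powR_ge0.
Qed.

Theorem hardy_sufficient p q f : 1 <= p -> p <= q -> cmeasurable f ->
  let beta := hardy_beta p q b M (fun n => Lnorm_on mu (hoelder_conjugate p) (X n) m) in
  beta < +oo ->
  hardy_lhs mu q X b M m f <= (hardy_const p q)%:E * beta * hardy_rhs mu p X b f.
Proof.
move=> p1 pq mf beta By; rewrite hardy_lhsE.
have beta0 : 0 <= beta.
  apply: le_trans (beta_ge p q b M _ 0); apply: mule_ge0.
    by apply/ltW/beta_left_gt0 => //; exact: le_trans pq.
  by apply: beta_right_ge0 => // n; exact: Lnorm_on_ge0.
have mmf := cmeasurableM mm mf.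
apply: (@le_trans _ _ ((hardy_const p q)%:E * beta *
    wlnorm p b (fun k => Lnorm_on mu p (X k) f))); last first.
  apply: lee_wpmul2l; last exact: wlnorm_le_hardy_rhs.
  by rewrite mule_ge0// lee_fin ltW// hardy_const_gt0.
apply: hardy_sequence => //.
- by move=> n; exact: Lnorm_on_ge0.
- by move=> n; exact: Lnorm_on_ge0.
- by move=> n; exact: abs_scaled_cintegral_ge0.
move=> n; have Mn : (0 < (M n)^-1)%R by rewrite invr_gt0.
apply: le_trans (abs_scaled_cintegral_le mu Mn (mXu n) mmf) _.
apply: lee_wpmul2l; first by rewrite lee_fin ltW.
rewrite ge0_integral_prefix; last 2 first.
- exact: measurable_cabs.
- by move=> x; exact: cabs_ge0.
by apply: lee_sum => k _; exact: hoelder_on.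
Qed.

(** This is conj(sgn m) phi, with value 0 where m vanishes because the inverse of
    0 is 0. *)
Definition test_fun phi (x : T) : R[i] :=
  ((phi x * (cabs (m x))^-1)%:C * (m x)^*)%C%R.

Lemma mul_test_fun phi x : (m x * test_fun phi x)%R = (cabs (m x) * phi x)%:C%C.
Proof.
have -> : (cabs (m x) * phi x = phi x * (cabs (m x))^-1 * cabs (m x) ^+ 2)%R.
  have [->|c0] := eqVneq (cabs (m x)) 0%R; first by rewrite expr0n/= mulr0 mul0r.
  by rewrite expr2 mulrA divfK// mulrC.
rewrite sqr_cabs /test_fun; case: (m x) => u v /=.
apply/eqP; rewrite eq_complex /=; apply/andP; split; apply/eqP; ring.
Qed.

Lemma cabs_test_fun phi x : (0 <= phi x)%R -> (cabs (test_fun phi x) <= phi x)%R.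
Proof.
move=> phi0; rewrite /test_fun cabsM cabs_real.
have -> : (cabs (m x)^*%C = cabs (m x))%R.
  by rewrite !cabsE; case: (m x) => u v /=; rewrite sqrrN.
rewrite ger0_norm ?mulr_ge0 ?invr_ge0 ?cabs_ge0//.
have [->|c0] := eqVneq (cabs (m x)) 0%R; first by rewrite mulr0.
by rewrite divfK.
Qed.

Lemma cmeasurable_test_fun phi : measurable_fun setT phi -> cmeasurable (test_fun phi).
Proof.
move=> mphi; have [mr mi] := mm.
have mV : measurable_fun setT (fun x => (phi x * (cabs (m x))^-1)%R).
  apply: measurable_funM => //.
  (* Measurability of the inverse comes from that of the power function. *)
  apply: (eq_measurable_fun (fun x => (cabs (m x)) `^ (-1))%R).
    by move=> x _; rewrite powR_inv1 ?cabs_ge0.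
  by apply: (measurableT_comp (measurable_powR (-1))); exact: measurable_cabs.
split.
- apply: (eq_measurable_fun (fun x => phi x * (cabs (m x))^-1 * complex.Re (m x))%R).
    by move=> x _; rewrite /test_fun; case: (m x) => u v /=; ring.
  exact: measurable_funM.
- apply: (eq_measurable_fun (fun x => - (phi x * (cabs (m x))^-1 * complex.Im (m x)))%R).
    by move=> x _; rewrite /test_fun; case: (m x) => u v /=; ring.
  by apply: measurableT_comp => //; exact: measurable_funM.
Qed.

(** As m f = |m| phi, the averages of the test function are plain integrals of
    nonnegative functions, and [wlnorm_ge] bounds the left-hand side from
    below. *)
Lemma hardy_test p q (C : R) phi (V : R) N : 1 <= q ->
  (forall f, cmeasurable f ->
    hardy_lhs mu q X b M m f <= C%:E * hardy_rhs mu p X b f) ->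
  measurable_fun setT phi -> (forall x, 0 <= phi x)%R -> (0 <= V)%R ->
  (forall n, (N <= n)%N -> V%:E <= \int[mu]_(x in Xu n) (cabs (m x) * phi x)%:E) ->
  beta_left q b M N * V%:E <= C%:E * hardy_rhs mu p X b (test_fun phi).
Proof.
move=> q1 H mphi phi0 V0 HV.
apply: le_trans (H _ (cmeasurable_test_fun mphi)).
rewrite hardy_lhsE; apply: wlnorm_ge => //.
  by move=> n; exact: abs_scaled_cintegral_ge0.
move=> n Nn; rewrite /avg; under eq_fun do rewrite mul_test_fun.
have Mn : (0 < (M n)^-1)%R by rewrite invr_gt0.
rewrite (@abs_scaled_cintegral_nnegE _ _ _ mu _ _
    (fun x => cabs (m x) * phi x)%R)//; last 2 first.
- by apply: measurable_funM => //; exact: measurable_cabs.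
- by move=> x; rewrite mulr_ge0 ?cabs_ge0.
by rewrite EFinM lee_pmul2l// HV.
Qed.

Lemma hardy_rhs_test (p : R) phi : (0 < p)%R ->
  measurable_fun setT phi -> (forall x, 0 <= phi x)%R ->
  hardy_rhs mu p%:E X b (test_fun phi) <=
  (\sum_(0 <= n <oo) (b n)%:E * \int[mu]_(x in X n) (phi x `^ p)%:E) `^ p^-1.
Proof.
move=> p0 mphi phi0.
have I0 f n : 0 <= (b n)%:E * \int[mu]_(x in X n) (cabs (f x) `^ p)%:E.
  rewrite mule_ge0// ?lee_fin ?(ltW (b0 n))//.
  by apply: integral_ge0 => x _; rewrite lee_fin powR_ge0.
apply: lee_poweR; first by rewrite invr_ge0 ltW.
  exact: nneseries_ge0.
apply: lee_nneseries => // n _; apply: lee_wpmul2l; first by rewrite lee_fin ltW.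
have mpow (h : T -> R) : measurable_fun setT h ->
    measurable_fun (X n) (fun x => (h x `^ p)%:E).
  move=> mh; apply: measurable_funTS; apply/measurable_EFinP.
  exact: (measurableT_comp (measurable_powR p)).
apply: ge0_le_integral => //.
- by move=> x _; rewrite lee_fin powR_ge0.
- by apply: mpow; apply: measurable_cabs; exact: cmeasurable_test_fun.
- exact: mpow.
- move=> x _; rewrite lee_fin ge0_ler_powR ?nnegrE ?cabs_ge0 ?(ltW p0)//.
  exact: cabs_test_fun.
Qed.

End measure_side.

(** * Necessity *)

(** Lets the bounds below be proved for real numbers V under the second factor W
    of beta, which may be infinite or not attained.  If x = +oo, the hypothesis
    leaves no room for W > 0. *)
Lemma lee_mul_of_lt_fin {R : realType} (x W : \bar R) (C : R) :
  0 < x -> (0 <= C)%R -> 0 <= W ->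
  (forall V : R, (0 < V)%R -> V%:E < W -> x * V%:E <= C%:E) -> x * W <= C%:E.
Proof.
move=> x0 C0 W0 h; case: x x0 h => [r||//] x0 h; last first.
  have : W <= 0.
    apply: lee_of_lt_fin => t tW; rewrite lee_fin leNgt; apply/negP => t0.
    by have := h t t0 tW; rewrite gt0_mulye.
  move=> W0'; have -> : W = 0 by apply/eqP; rewrite eq_le W0 W0'.
  by rewrite mule0 lee_fin.
rewrite lte_fin in x0.
rewrite muleC -lee_pdivlMr// -EFinM; apply: lee_of_lt_fin => t tW; rewrite lee_fin.
have [t0|t0] := leP t 0%R; first by rewrite (le_trans t0)// divr_ge0// ltW.
by rewrite ler_pdivlMr// mulrC -lee_fin EFinM h.
Qed.

Section necessity.
Context d (T : measurableType d) (R : realType).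
Variable mu : {measure set T -> \bar R}.
Variables (X : nat -> set T) (b M : nat -> R) (m : T -> R[i]).
Hypothesis mX : forall n, measurable (X n).
Hypothesis tX : trivIset [set: nat] X.
Hypothesis cX : \bigcup_n X n = [set: T].
Hypothesis b0 : forall n, (0 < b n)%R.
Hypothesis M0 : forall n, (0 < M n)%R.
Hypothesis mm : cmeasurable m.
Implicit Types (p q : \bar R) (f : T -> R[i]) (phi : T -> R).

Let Xu n := \bigcup_(k in `I_n.+1) X k.

Let hardy_bound p q (C : R) := forall f, cmeasurable f ->
  hardy_lhs mu q X b M m f <= C%:E * hardy_rhs mu p X b f.

Let mabs : measurable_fun setT (fun x => cabs (m x)).
Proof. exact: measurable_cabs. Qed.

(** Tested with phi = 1: then the right-hand side is at most C and the averages
    are those of |m|. *)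
Lemma necessity_infty (C : R) N : (0 < C)%R -> hardy_bound +oo +oo C ->
  beta_left +oo b M N * beta_right +oo b (fun n => Lnorm_on mu 1 (X n) m) N <= C%:E.
Proof.
move=> C0 H; apply: lee_mul_of_lt_fin; first by apply: beta_left_gt0 => //; rewrite leey.
- exact: ltW.
- by apply: beta_right_ge0 => // n; exact: Lnorm_on_ge0.
move=> V V0 VW.
have -> : C%:E = C%:E * 1 by rewrite mule1.
apply: le_trans
  (hardy_test mX b0 M0 mm (phi := fun=> 1%R) (leey 1) H _ _ (ltW V0) _) _ => //.
- move=> n Nn; apply: (le_trans (ltW VW)).
  under eq_integral do rewrite mulr1.
  rewrite (ge0_integral_prefix mu mX tX n mabs); last by move=> x; exact: cabs_ge0.
  rewrite /beta_right (@big_cat_nat _ _ _ N.+1 0 n.+1)//= lee_paddr//.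
    apply: sume_ge0 => k _; apply: integral_ge0 => x _.
    by rewrite lee_fin; exact: cabs_ge0.
  apply: lee_sum => k _; rewrite Lnorm_onE// invr1 poweRe1.
    rewrite le_eqVlt; apply/orP; left; apply/eqP; apply: eq_integral => x _.
    by rewrite powRr1// cabs_ge0.
  by apply: integral_ge0 => x _; rewrite lee_fin powR_ge0.
- rewrite lee_pmul2l ?lte_fin// /hardy_rhs /Lnorm_on unlock; case: ifPn => // _.
  apply/ess_supP; apply: nearW => x /=; rewrite patchE.
  case: ifP => _; last by rewrite abse0.
  by rewrite gee0_abs ?lee_fin ?cabs_ge0//; exact: cabs_test_fun.
Qed.

(** For V < w_k / b_k put t = V b_k.  The set where |m| > t in X_k has positive
    measure, hence contains a set A of positive finite measure, and the
    indicator of A gives beta_left * t mu(A) <= C b_k mu(A). *)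
Lemma necessity_one q (C : R) N : 1 <= q -> semifinite mu -> (0 < C)%R ->
  hardy_bound 1 q C ->
  beta_left q b M N * beta_right 1 b (fun n => Lnorm_on mu +oo (X n) m) N <= C%:E.
Proof.
move=> q1 smu C0 H; rewrite /beta_right eqxx big_seq.
apply: (big_ind (fun y => beta_left q b M N * y <= C%:E)).
- by rewrite mule0 lee_fin ltW.
- by move=> x y hx hy; rewrite maxEle; case: ifP.
move=> k; rewrite mem_index_iota ltnS => /andP[_ kN].
apply: lee_mul_of_lt_fin; first exact: beta_left_gt0.
- exact: ltW.
- by rewrite mule_ge0 ?Lnorm_on_ge0// lee_fin invr_ge0 ltW.
move=> V V0; rewrite lte_pdivlMr// -EFinM.
set t := (V * b k)%R => tw.
have t0 : (0 < t)%R by rewrite mulr_gt0.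
pose F := (fun x => (cabs (m x))%:E) \_ (X k).
have mF : measurable_fun setT F.
  apply/(measurable_restrictT _ (mX k)).1; apply: measurable_funTS.
  exact/measurable_EFinP.
pose E := F @^-1` `]t%:E, +oo[.
have mE : measurable E by rewrite -[E]setTI; apply: mF => //; exact/emeasurable_itv.
have EP x : E x -> X k x /\ (t < cabs (m x))%R.
  rewrite /E/= in_itv/= andbT /F patchE; case: ifPn; first by rewrite inE lte_fin.
  by rewrite lte_fin ltNge (ltW t0).
have E0 : 0 < mu E.
  rewrite lt0e measure_ge0 andbT; apply/eqP => /ae_le_measureP => /(_ mF) Ft.
  move: tw; rewrite ltNge => /negP; apply.
  rewrite /Lnorm_on unlock; case: ifPn => _; last by rewrite lee_fin ltW.
  apply/ess_supP; apply: filterS Ft => x /=.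
  rewrite gee0_abs// patchE; case: ifP => // _; rewrite lee_fin cabs_ge0//.
have [A [mA AE /andP[A0 Ay]]] := semifinite_gt0_subset smu mE E0.
have Af : mu A \is a fin_num by rewrite ge0_fin_numE.
set a := fine (mu A); have aE : mu A = a%:E by rewrite fineK.
have a0 : (0 < a)%R by rewrite -lte_fin -aE.
have AX : A `<=` X k by move=> x /AE/EP[].
have AXu n : (N <= n)%N -> A `<=` Xu n.
  by move=> Nn x /AX Xk; exists k => //=; rewrite ltnS (leq_trans kN).
have mphi : measurable_fun setT (\1_A : T -> R) by exact: measurable_indic.
have V'0 : (0 <= t * a)%R by rewrite mulr_ge0// ltW.
have := hardy_test mX b0 M0 mm q1 H mphi (fun x => _) V'0 (N := N).
have phi0 x : (0 <= (\1_A : T -> R) x)%R by rewrite indicE.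
move=> /(_ phi0).
have : hardy_rhs mu 1 X b (test_fun m \1_A) <= (b k * a)%:E.
  apply: le_trans (hardy_rhs_test mu mX b0 mm ltr01 mphi phi0) _.
  have IE n : \int[mu]_(x in X n) ((\1_A x : R) `^ 1)%:E = mu (A `&` X n).
    rewrite -integral_indic//; apply: eq_integral => x _.
    by rewrite powRr1.
  rewrite invr1 poweRe1; last first.
    apply: nneseries_ge0 => n _ _; rewrite IE mule_ge0// lee_fin ltW//.
  rewrite (@nneseriesD1 _ _ k)//; last first.
    by move=> n _; rewrite IE mule_ge0// lee_fin ltW.
  rewrite eseries0 ?adde0.
    by rewrite IE (setIidl AX) aE.
  move=> n _ /= nk; rewrite IE (_ : A `&` X n = set0) ?measure0 ?mule0//.
  apply/seteqP; split => // x [/AX Xk Xn]; move/negP: nk; apply; apply/eqP.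
  by apply: tX => //; exists x.
move=> rhs_le /(_ _)/le_trans h.
have : beta_left q b M N * (t * a)%:E <= C%:E * (b k * a)%:E.
  apply: h; last by rewrite lee_pmul2l.
  move=> n Nn.
  apply: (@le_trans _ _ (\int[mu]_(x in A) (cabs (m x) * (\1_A x : R))%:E)); last first.
    apply: ge0_subset_integral => //.
    - by apply: bigcup_measurable => *; exact: mX.
    - by apply: measurable_funTS; apply/measurable_EFinP; exact: measurable_funM.
    - by move=> x _; rewrite lee_fin mulr_ge0 ?cabs_ge0.
    - exact: AXu.
  rewrite EFinM -aE -integral_cst//; apply: ge0_le_integral => //.
  - by move=> x _; rewrite lee_fin ltW.
  - by apply: measurable_funTS; apply/measurable_EFinP; exact: measurable_funM.
  - move=> x Ax; rewrite indicE mem_set// mulr1 lee_fin ltW//.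
    by have [] := EP _ (AE _ Ax).
have ba : (0 < b k * a)%R by rewrite mulr_gt0.
have -> : (t * a)%:E = V%:E * (b k * a)%:E by rewrite -EFinM /t mulrA.
by rewrite muleA lee_pmul2r.
Qed.

(** With rho = b_k^(-p'/p) on X_k for k <= N and 0 elsewhere, the function
    h = |m|^p' rho has beta_right^p' as its integral.  The test function
    phi = |m|^(p'-1) rho 1_A satisfies |m| phi = h 1_A and, as 1 - p' = -p'/p,
    also b_k phi^p = h 1_A on X_k.  So if V is the integral of h on A, the
    inequality says beta_left * V <= C V^(1/p), that is
    beta_left * V^(1/p') <= C. *)
Lemma necessity_gt1 (p : R) q (C : R) N : (1 < p)%R -> 1 <= q -> (0 < C)%R ->
  let w := fun n => Lnorm_on mu (hoelder_conjugate p%:E) (X n) m in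
  semifinite mu \/ (forall n, w n < +oo) -> hardy_bound p%:E q C ->
  beta_left q b M N * beta_right p%:E b w N <= C%:E.
Proof.
move=> p1 q1 C0 w sw H.
have p0 : (0 < p)%R := lt_trans ltr01 p1.
set p' := (p / (p - 1))%R; have p'0 : (0 < p')%R by exact: hoelder_conj_gt0.
have pp' : (p^-1 + p'^-1 = 1)%R by exact: hoelder_conj_sum1.
have wE n : w n = (\int[mu]_(x in X n) (cabs (m x) `^ p')%:E) `^ p'^-1.
  by rewrite /w hoelder_conjugate_fin// Lnorm_onE.
pose c k := ((b k `^ (p' / p))^-1)%R.
have c0 k : (0 < c k)%R by rewrite invr_gt0 powR_gt0.
pose rho x : R := (\sum_(0 <= k < N.+1) c k * \1_(X k) x)%R.
have mrho : measurable_fun setT rho.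
  by apply: measurable_sum => k; apply: measurable_funM => //; exact: measurable_indic.
have rho0 x : (0 <= rho x)%R.
  by apply: sumr_ge0 => k _; rewrite mulr_ge0 ?(ltW (c0 k))// indicE.
have rhoE n x : X n x -> rho x = if (n <= N)%N then c n else 0%R.
  move=> Xnx.
  have z k : k != n -> (c k * \1_(X k) x = 0)%R.
    move=> kn; rewrite indicE memNset ?mulr0// => Xkx; move/eqP: kn; apply.
    by apply: tX => //; exists x.
  rewrite /rho; case: ifP => nN.
    rewrite (bigD1_seq n) ?iota_uniq ?mem_index_iota//=.
    by rewrite big1 ?addr0// ?indicE ?mem_set ?mulr1.
  rewrite big1_seq// => k /=; rewrite mem_index_iota ltnS => /andP[_ kN].
  by apply: z; apply: contraFneq nN => <-.
pose h x := (cabs (m x) `^ p' * rho x)%R.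
have mpow r : measurable_fun setT (fun x => cabs (m x) `^ r)%R.
  exact: (measurableT_comp (measurable_powR r)).
have mh : measurable_fun setT h by exact: measurable_funM.
have h0 x : (0 <= h x)%R by rewrite mulr_ge0 ?powR_ge0.
have hXu n x : (N <= n)%N -> ~ Xu n x -> h x = 0%R.
  move=> Nn nx; have : (\bigcup_n X n) x by rewrite cX.
  move=> [k _ Xk]; rewrite /h (rhoE _ _ Xk) ifF ?mulr0//.
  apply/negP => kN; apply: nx; exists k => //=.
  by rewrite ltnS (leq_trans kN).
have restrict_h (A : set T) n : (N <= n)%N ->
    \int[mu]_(x in A) (h x)%:E = \int[mu]_(x in Xu n) (h x * \1_A x)%:E.
  move=> Nn; rewrite [LHS]integral_mkcond [RHS]integral_mkcond.
  apply: eq_integral => x _; rewrite !patchE indicE.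
  case: (boolP (x \in A)) => xA; case: ifPn => //; rewrite ?mulr1 ?mulr0//.
  by rewrite notin_setE => /(hXu _ _ Nn) ->.
have brE : beta_right p%:E b w N = (\int[mu]_x (h x)%:E) `^ p'^-1.
  rewrite /beta_right gt_eqF// hoelder_conjugate_fin//= -/p'; congr (_ `^ _).
  rewrite (restrict_h _ N)//.
  under [RHS]eq_integral do rewrite indicT mulr1.
  rewrite ge0_integral_prefix//; rewrite !big_seq; apply: eq_bigr => k.
  rewrite mem_index_iota ltnS => /andP[_ kN].
  have I0 : 0 <= \int[mu]_(x in X k) (cabs (m x) `^ p')%:E.
    by apply: integral_ge0 => x _; rewrite lee_fin powR_ge0.
  rewrite wE -poweRrM mulVf ?gt_eqF// poweRe1// muleC -ge0_integralZl_EFin//.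
  - apply: eq_integral => x; rewrite inE => Xk.
    by rewrite /h (rhoE _ _ Xk) kN -EFinM mulrC.
  - by move=> x _; rewrite lee_fin powR_ge0.
  - by apply: measurable_funTS; apply/measurable_EFinP.
  - exact: (ltW (c0 k)).
apply: lee_mul_of_lt_fin; first exact: beta_left_gt0.
- exact: ltW.
- by apply: beta_right_ge0 => // n; exact: Lnorm_on_ge0.
move=> V V0 VW.
have Vh : (V `^ p')%:E < \int[mu]_x (h x)%:E.
  rewrite ltNge; apply/negP => hV; move: VW; rewrite ltNge => /negP; apply.
  rewrite brE; apply: poweR_le_root => //; last exact: ltW.
  by apply: integral_ge0 => x _; rewrite lee_fin.
(* A can be the whole space unless h has infinite integral; in that case some
   w_k is +oo and semi-finiteness is at hand. *)
have [A [mA /andP[VA Ay]]] : exists A, measurable A /\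
    (V `^ p')%:E < \int[mu]_(x in A) (h x)%:E < +oo.
  have [hy|hy] := eqVneq (\int[mu]_x (h x)%:E) +oo; last first.
    by exists setT; split => //; rewrite Vh ltey.
  case: sw => [smu|wfin]; first exact: semifinite_large_integral.
  exfalso; have : beta_right p%:E b w N < +oo.
    rewrite /beta_right gt_eqF// hoelder_conjugate_fin//= -/p' poweR_lty//.
    apply: lte_sum_pinfty => k _; apply: lte_mul_pinfty.
    - exact: poweR_ge0.
    - by rewrite ge0_fin_numE ?poweR_ge0// poweR_lty// wfin.
    - exact: ltry.
  by rewrite brE hy poweRyr// invr_eq0 gt_eqF.
have Af : \int[mu]_(x in A) (h x)%:E \is a fin_num.
  by rewrite ge0_fin_numE//; apply: integral_ge0 => x _; rewrite lee_fin.
set VV := fine (\int[mu]_(x in A) (h x)%:E).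
have VVE : \int[mu]_(x in A) (h x)%:E = VV%:E by rewrite fineK.
rewrite VVE lte_fin in VA.
have VV0 : (0 < VV)%R by rewrite (le_lt_trans _ VA)// powR_ge0.
pose phi x := (cabs (m x) `^ (p' - 1) * rho x * \1_A x)%R.
have mphi : measurable_fun setT phi.
  by apply: measurable_funM; [exact: measurable_funM|exact: measurable_indic].
have phi0 x : (0 <= phi x)%R by rewrite !mulr_ge0 ?powR_ge0// indicE.
have mphiE x : (cabs (m x) * phi x = h x * \1_A x)%R.
  by rewrite /phi /h !mulrA mulr_powRB1// cabs_ge0.
have := hardy_test mX b0 M0 mm q1 H mphi phi0 (ltW VV0) (N := N).
have rhs_le : hardy_rhs mu p%:E X b (test_fun m phi) <= (VV `^ p^-1)%:E.
  apply: le_trans (hardy_rhs_test mu mX b0 mm p0 mphi phi0) _.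
  rewrite -poweR_EFin -VVE le_eqVlt; apply/orP; left; apply/eqP; congr (_ `^ _).
  have mhA : measurable_fun setT (fun x => h x * \1_A x)%R.
    by apply: measurable_funM => //; exact: measurable_indic.
  have -> : \int[mu]_(x in A) (h x)%:E = \int[mu]_x (h x * \1_A x)%:E.
    rewrite [LHS]integral_mkcond; apply: eq_integral => x _.
    by rewrite patchE indicE; case: ifP => _; rewrite ?mulr1 ?mulr0.
  rewrite -cX ge0_integral_bigcup//; last 2 first.
  - by rewrite cX; apply/measurable_EFinP.
  - by move=> x _; rewrite lee_fin mulr_ge0// indicE.
  apply: eq_eseriesr => n _; rewrite -ge0_integralZl_EFin//; last 3 first.
  - by move=> x _; rewrite lee_fin powR_ge0.
  - apply: measurable_funTS; apply/measurable_EFinP.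
    exact: (measurableT_comp (measurable_powR p)).
  - exact: ltW.
  apply: eq_integral => x; rewrite inE => Xnx; rewrite -EFinM; congr EFin.
  rewrite /phi /h (rhoE _ _ Xnx) !powRM ?mulr_ge0 ?powR_ge0//; last 2 first.
  - by case: ifP => // _; exact: ltW.
  - by case: ifP => // _; exact: ltW.
  rewrite -powRrM.
  have -> : ((p' - 1) * p = p')%R by rewrite /p'; field; rewrite subr_eq0 gt_eqF.
  have -> : ((\1_A x : R) `^ p = \1_A x)%R.
    by rewrite indicE; case: (x \in A); rewrite ?powR1// powR0// gt_eqF.
  rewrite !mulrA; congr (_ * _)%R; rewrite [LHS]mulrAC [RHS]mulrC; congr (_ * _)%R.
  case: ifP => _; last by rewrite powR0 ?gt_eqF// mulr0.
  rewrite /c -powRN -powRrM -[X in (X * _)%R](powRr1 (ltW (b0 n))).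
  rewrite -powRD; last by rewrite (gt_eqF (b0 n)) implybT.
  congr (_ `^ _)%R.
  by rewrite /p'; field; rewrite gt_eqF//= subr_eq0 gt_eqF.
move=> /(_ _)/le_trans/(_ (lee_wpmul2l _ rhs_le)) hb.
have {}hb : beta_left q b M N * VV%:E <= C%:E * (VV `^ p^-1)%:E.
  apply: hb; last by rewrite lee_fin ltW.
  move=> n Nn; under eq_integral do rewrite mphiE.
  by rewrite -(restrict_h A n Nn) VVE.
have VVs : VV = (VV `^ p'^-1 * VV `^ p^-1)%R.
  by rewrite -powRD ?(addrC p'^-1)%R pp' ?oner_eq0// powRr1// ltW.
rewrite [in X in X <= _]VVs EFinM muleA lee_pmul2r// ?lte_fin ?powR_gt0// in hb.
apply: le_trans hb; apply: lee_wpmul2l; first by apply/ltW; exact: beta_left_gt0.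
rewrite lee_fin -[leLHS](@powRKV _ _ p') ?gt_eqF ?(ltW V0)//.
by rewrite ge0_ler_powR ?nnegrE ?invr_ge0 ?powR_ge0 ?(ltW p'0) ?(ltW VV0) ?(ltW VA).
Qed.

End necessity.

(** * The characterization *)

Theorem corollary2 (d : measure_display) (T : measurableType d) (R : realType)
    (mu : {measure set T -> \bar R}) (p q : \bar R)
    (X : nat -> set T) (b M : nat -> R) (m : T -> R[i])
    (p_ge1 : 1 <= p) (le_pq : p <= q)
    (semifinite_mu : p = 1 -> semifinite mu)
    (measurable_X : forall n, measurable (X n))
    (trivIset_X : trivIset [set: nat] X)
    (cover_X : \bigcup_n X n = [set: T])
    (b_gt0 : forall n, (0 < b n)%R) (M_gt0 : forall n, (0 < M n)%R)
    (measurable_m : cmeasurable m) :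
  let w := fun n => Lnorm_on mu (hoelder_conjugate p) (X n) m in
  let beta := hardy_beta p q b M w in
  forall w_fin : 1 < p -> p < +oo ->
    semifinite mu \/ (forall n, w n < +oo),
  ((exists C : R, (0 < C)%R /\
      forall f : T -> R[i], cmeasurable f ->
        hardy_lhs mu q X b M m f <= C%:E * hardy_rhs mu p X b f)
   <-> beta < +oo)
  /\
  (beta < +oo ->
   forall f : T -> R[i], cmeasurable f ->
     hardy_lhs mu q X b M m f <=
       (hardy_const p q)%:E * beta * hardy_rhs mu p X b f).
Proof.
move=> w beta w_fin.
have q1 : 1 <= q := le_trans p_ge1 le_pq.
have sufficient f : beta < +oo -> cmeasurable f ->
    hardy_lhs mu q X b M m f <= (hardy_const p q)%:E * beta * hardy_rhs mu p X b f.
  by move=> beta_fin mf; exact: hardy_sufficient.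
split; last by move=> beta_fin f mf; exact: sufficient.
split=> [[C [C0 HC]]|beta_fin].
  apply: le_lt_trans (ltry C); apply: ge_ereal_sup => _ [N _ <-].
  case: p p_ge1 le_pq semifinite_mu @w @beta w_fin HC {sufficient} =>
    [r||//] r1 rq smu w beta w_fin HC; last first.
    have qE : q = +oo by apply/eqP; rewrite -leye_eq.
    rewrite qE in HC; rewrite /w hoelder_conjugatey qE.
    exact: necessity_infty HC.
  have [r_eq1|rN1] := eqVneq r 1%R.
    rewrite /w; rewrite r_eq1 in smu HC *; rewrite hoelder_conjugate1.
    by apply: necessity_one => //; exact: smu.
  have {}r1 : (1 < r)%R by rewrite lt_neqAle eq_sym rN1 -lee_fin.
  by apply: necessity_gt1 => //; apply: w_fin; rewrite ?lte_fin ?ltry.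
have beta0 : 0 <= beta.
  apply: le_trans (beta_ge p q b M w 0); apply: mule_ge0.
    exact/ltW/beta_left_gt0.
  by apply: beta_right_ge0 => // n; exact: Lnorm_on_ge0.
have K0 := hardy_const_gt0 p_ge1 le_pq.
(* Adding 1 keeps the constant positive when beta = 0. *)
exists (hardy_const p q * fine beta + 1)%R; split.
  by rewrite ltr_wpDl// mulr_ge0 ?fine_ge0// ltW.
move=> f mf; apply: le_trans (sufficient f beta_fin mf) _.
apply: lee_wpmul2r.
  by apply: le_trans (wlnorm_le_hardy_rhs mu X b p_ge1 mf);
    apply: wlnorm_ge0 => // n; exact: Lnorm_on_ge0.
by rewrite EFinD (EFinM (hardy_const p q)) fineK ?ge0_fin_numE// leeDl.
Qed.
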